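(* For every constant integer $k\ge 4$, the $k$-AP Hypothesis implies the $(k,k-1)$-Hyperclique Hypothesis.
   Context: A $k$-term arithmetic progression ($k$-AP) is a sequence $x,x+d,\dots,x+(k-1)d$; it is non-trivial if $d\neq 0$. $k$-AP Hypothesis: there is no algorithm that decides whether a given set $A\subseteq\{0,\dots,N\}$ contains a non-trivial $k$-AP in time $O(N^{2-\epsilon})$ for any constant $\epsilon>0$. $(k,h)$-Hyperclique Hypothesis: there is no algorithm that detects a $k$-clique (a set of $k$ vertices all of whose $h$-element subsets are hyperedges) in an $h$-uniform $n$-vertex hypergraph in time $O(n^{k-\epsilon})$ for any constant $\epsilon>0$. *)

(* Defs.v *)
(* Reals comes first: it would rebind nat_scope notations such as [_ ^ _]. *)
From Stdlib Require Import Reals.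
From mathcomp Require Import all_boot.

Set Implicit Arguments.
Unset Strict Implicit.
Unset Printing Implicit Defensive.

(* [%R] denotes MathComp's ring_scope here. *)
Delimit Scope R_scope with coqR.

(** * Word RAM

    Programs are structured (sequence, conditional, loop) over word registers
    [0, 1, 2, ...] and finitely many random-access arrays.  This is the usual
    word RAM up to constant factors: a jump program is one loop over a program
    counter held in a register, and finitely many arrays can be interleaved in
    one memory.  Every instruction and every test costs one step. *)

Inductive binop : Set :=
| Add | Sub | Mul | Div | Mod | And | Or | Xor | Shl | Shr | Eq | Lt.

(* [Sub] is truncated at 0; division by 0 follows [divn] and [modn]. *)
Definition eval_binop (o : binop) (m n : nat) : nat :=
  match o with
  | Add => m + n
  | Sub => m - n
  | Mul => m * n
  | Div => m %/ n
  | Mod => m %% n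
  | And => Nat.land m n
  | Or => Nat.lor m n
  | Xor => Nat.lxor m n
  | Shl => m * 2 ^ n
  | Shr => m %/ 2 ^ n
  | Eq => m == n
  | Lt => m < n
  end.

Inductive cmd : Set :=
| Const (r c : nat)              (* r := c *)
| Move (r x : nat)               (* r := x *)
| Op (o : binop) (r x y : nat)   (* r := x o y *)
| Read (r a x : nat)             (* r := a[x] *)
| Write (a x y : nat)            (* a[x] := y *)
| Seq (p q : cmd)
| If (x : nat) (p q : cmd)       (* the test is x <> 0 *)
| While (x : nat) (p : cmd).     (* the test is x <> 0 *)

Record state := State { reg : nat -> nat; arr : nat -> nat -> nat }.

Definition upd (T : Type) (f : nat -> T) (i : nat) (v : T) (j : nat) : T :=
  if j == i then v else f j.

Definition set_reg (s : state) (r v : nat) : state :=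
  State (upd (reg s) r v) (arr s).

Definition set_arr (s : state) (a i v : nat) : state :=
  State (reg s) (upd (arr s) a (upd (arr s a) i v)).

(* [exec w p s t s']: with words of [w] bits, [p] started in [s] halts in [s']
   after [t] steps.  A run that would write a value not fitting in a word has
   no outcome; in particular all array indices formed by a program fit in a
   word.  Hence a run with an outcome is the same for every larger [w]. *)
Inductive exec (w : nat) : cmd -> state -> nat -> state -> Prop :=
| exec_Const r c s :
    c < 2 ^ w -> exec w (Const r c) s 1 (set_reg s r c)
| exec_Move r x s :
    reg s x < 2 ^ w -> exec w (Move r x) s 1 (set_reg s r (reg s x))
| exec_Op o r x y s :
    eval_binop o (reg s x) (reg s y) < 2 ^ w ->
    exec w (Op o r x y) s 1 (set_reg s r (eval_binop o (reg s x) (reg s y)))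
| exec_Read r a x s :
    arr s a (reg s x) < 2 ^ w ->
    exec w (Read r a x) s 1 (set_reg s r (arr s a (reg s x)))
| exec_Write a x y s :
    reg s y < 2 ^ w ->
    exec w (Write a x y) s 1 (set_arr s a (reg s x) (reg s y))
| exec_Seq p q s t s1 u s2 :
    exec w p s t s1 -> exec w q s1 u s2 -> exec w (Seq p q) s (t + u) s2
| exec_IfT x p q s t s1 :
    reg s x <> 0 -> exec w p s t s1 -> exec w (If x p q) s t.+1 s1
| exec_IfF x p q s t s1 :
    reg s x = 0 -> exec w q s t s1 -> exec w (If x p q) s t.+1 s1
| exec_WhileT x p s t s1 u s2 :
    reg s x <> 0 -> exec w p s t s1 -> exec w (While x p) s1 u s2 ->
    exec w (While x p) s (t + u).+1 s2
| exec_WhileF x p s :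
    reg s x = 0 -> exec w (While x p) s 1 s.

(* Size parameter in register 0, input in array 0, everything else zero. *)
Definition init (n : nat) (input : nat -> nat) : state :=
  State (upd (fun=> 0) 0 n) (upd (fun=> (fun=> 0)) 0 input).

(** * Decision problems and running time *)

(* Instances are graded by the parameter in which running time is measured. *)
Record problem := Problem {
  instance : nat -> Type;
  encode : forall n, instance n -> nat -> nat;
  yes : forall n, instance n -> Prop
}.

(* The number of bits of [n] (1 when [n = 0]). *)
Definition bits (n : nat) : nat := (trunc_log 2 n).+1.

(* [P] is decided in time O(n ^ e) on a word RAM with O(log n)-bit words. The
   answer is "yes" iff register 0 is finally nonzero.  The program must be
   correct for every [n]; asking for the time bound at all [n > 0] rather than
   at all large [n] is harmless, since each [n] has finitely many inputs. *)
Definition decidable_in_time (P : problem) (e : R) : Prop :=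
  exists (p : cmd) (c : nat) (C : R),
  forall (n : nat) (I : instance P n),
  exists (t : nat) (s : state),
    [/\ exec (c * bits n) p (init n (encode I)) t s,
        yes I <-> reg s 0 <> 0
      & 0 < n -> (INR t <= C * Rpower (INR n) e)%coqR].

(** * Arithmetic progressions *)

Definition has_nontrivial_AP (k N : nat) (A : {set 'I_N.+1}) : Prop :=
  exists x d : Z, d <> 0%Z /\
  forall i : nat, i < k ->
  exists2 a : 'I_N.+1, a \in A & Z.of_nat a = (x + Z.of_nat i * d)%Z.

(* [A] is given by its characteristic vector. *)
Definition AP_encode (N : nat) (A : {set 'I_N.+1}) (j : nat) : nat :=
  [exists a in A, j == a :> nat].

Definition AP_problem (k : nat) : problem :=
  {| instance := fun N => {set 'I_N.+1};
     encode := AP_encode;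
     yes := has_nontrivial_AP k |}.

Definition AP_hypothesis (k : nat) : Prop :=
  ~ exists eps : R, (0 < eps)%coqR /\
    decidable_in_time (AP_problem k) (2 - eps)%coqR.

(** * Hypercliques *)

Definition hypergraph (h n : nat) : Type :=
  {E : {set {set 'I_n}} | [forall e in E, #|e| == h]}.

Definition has_clique (k h n : nat) (G : hypergraph h n) : Prop :=
  exists S : {set 'I_n}, #|S| = k /\
  forall e : {set 'I_n}, e \subset S -> #|e| = h -> e \in val G.

(* [G] is given by its [n * ... * n] adjacency tensor ([h] factors): the entry
   of [(v_0, ..., v_(h-1))], which tells whether [{v_0, ..., v_(h-1)}] is a
   hyperedge, is at index [v_0 + v_1 * n + ... + v_(h-1) * n ^ (h-1)]. *)
Definition hypergraph_encode (h n : nat) (G : hypergraph h n) (j : nat) : nat :=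
  [exists v : h.-tuple 'I_n,
    (j == \sum_(i < h) tnth v i * n ^ i) && ([set x in v] \in val G)].

Definition hyperclique_problem (k h : nat) : problem :=
  {| instance := hypergraph h;
     encode := @hypergraph_encode h;
     yes := @has_clique k h |}.

Definition hyperclique_hypothesis (k h : nat) : Prop :=
  ~ exists eps : R, (0 < eps)%coqR /\
    decidable_in_time (hyperclique_problem k h) (INR k - eps)%coqR.

(* Main.v *)
(* A difference d in [1, N] is 1 + \sum_(j < k) v_j n^j for the base-n digits
   v_j of d - 1, where n^k >= N.  With y = x + \sum_j j v_j n^j, the i-th term
   x + i d of a progression equals y + i + \sum_j (i - j) v_j n^j and so does not
   depend on v_i.  Hence, for fixed y, the progressions in A are the cliques of
   a k-partite (k-1)-uniform hypergraph with n vertices v_j in each part.  There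
   are O(N) values of y, and n = O(N^(1/k)), so an O(n^(k - eps)) clique
   algorithm run on each of these hypergraphs takes time O(N^(2 - eps / k)).

   On the word RAM, each run takes place in a region of memory that is still
   zero: the addresses used by the clique algorithm on V vertices are below
   2^(c * bits V) <= (2 V)^c, so run number y is shifted by y (2 V)^c. *)

From Stdlib Require Import ZArith Reals Lra.
Require Import Defs.
From mathcomp Require Import all_boot zify.

Set Implicit Arguments.
Unset Strict Implicit.
Unset Printing Implicit Defensive.

(** A run has no outcome once a value leaves the word, so every intermediate value of the reduction
    has to be bounded. The arithmetic is therefore written as expressions whose [cost] counts steps
    and, as an exponent, bounds the value: all data are at most some [B] polynomial in N, and
    [B ^ cost] fits in O(log N) bits. Regions are shifted rather than cleared because the (2 V)^c
    cells of a region may far outnumber the steps of a run, while even the highest address stays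
    polynomial in N. The clique problem knows nothing of parts. A clique nevertheless has one vertex
    in each part: hyperedges only join vertices of distinct parts, and any two of its k >= 3
    vertices lie in a common hyperedge. Writing the adjacency tensor costs V^(k - 1) steps for each
    y, so at most 1 can be saved in the exponent of a round; hence the final saving is min(eps, 1) /
    k. *)

Definition runs (w : nat) (p : cmd) (s : state) (T : nat) (Q : state -> Prop) :=
  exists t s', [/\ exec w p s t s', t <= T & Q s'].

Lemma runs_seq w p q s T1 T2 (Q1 Q : state -> Prop) :
  runs w p s T1 Q1 -> (forall s', Q1 s' -> runs w q s' T2 Q) ->
  runs w (Seq p q) s (T1 + T2) Q.
Proof.
move=> [t [s1 [p_s1 le_t /[swap]]]] /[apply] [[u [s2 [q_s2 le_u Qs2]]]].
exists (t + u), s2; split=> //; [exact: exec_Seq p_s1 q_s2 | exact: leq_add].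
Qed.

Lemma runs_weaken w p s T T' (Q Q' : state -> Prop) :
  runs w p s T Q -> T <= T' -> (forall s', Q s' -> Q' s') -> runs w p s T' Q'.
Proof.
move=> [t [s' [p_s' le_t Qs']]] le_T QQ'.
by exists t, s'; split; [| exact: leq_trans le_T | exact: QQ'].
Qed.

Lemma upd_same (T : Type) (f : nat -> T) i v : upd f i v i = v.
Proof. by rewrite /upd eqxx. Qed.

Lemma upd_other (T : Type) (f : nat -> T) i v j : j != i -> upd f i v j = f j.
Proof. by rewrite /upd => /negbTE->. Qed.

Lemma exec_monotone w w' p s t s' :
  w <= w' -> exec w p s t s' -> exec w' p s t s'.
Proof.
move=> le_w; have le_pow m : m < 2 ^ w -> m < 2 ^ w'.
  by move=> /leq_trans; apply; rewrite leq_exp2l.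
elim=> *; by [constructor; auto | econstructor; eauto].
Qed.

(** * Expressions *)

Inductive expr : Set :=
| EConst (c : nat)
| EReg (r : nat)
| EGet (e : expr)
| EOp (o : binop) (e1 e2 : expr).

Fixpoint eval (s : state) (e : expr) : nat :=
  match e with
  | EConst c => c
  | EReg r => reg s r
  | EGet e => arr s 0 (eval s e)
  | EOp o e1 e2 => eval_binop o (eval s e1) (eval s e2)
  end.

(** Plays two roles: the number of steps of the compiled code, and the exponent in the bound
    [B ^ cost e] on the value. *)
Fixpoint cost (e : expr) : nat :=
  match e with
  | EConst _ | EReg _ => 1
  | EGet e => (cost e).+1
  | EOp _ e1 e2 => (cost e1 + cost e2).+1
  end.

Fixpoint compile (d : nat) (e : expr) : cmd :=
  match e with
  | EConst c => Const d c
  | EReg r => Move d r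
  | EGet e => Seq (compile d e) (Read d 0 d)
  | EOp o e1 e2 =>
      Seq (compile d e1) (Seq (compile d.+1 e2) (Op o d d d.+1))
  end.

(** Each of these operations, applied to arguments at most [x] and [y] with [x, y >= 1], yields at
    most [2 * x * y]. A left shift would grow exponentially. *)
Definition arithmetic (o : binop) : bool :=
  match o with
  | Add | Defs.Sub | Mul | Div | Mod | Eq | Lt => true
  | And | Or | Xor | Shl | Shr => false
  end.

(** Registers from [d] on are scratch space of the compiled code, so an expression may only read
    registers below [d]. *)
Fixpoint fits (B d : nat) (s : state) (e : expr) : bool :=
  match e with
  | EConst c => c <= B
  | EReg r => (r < d) && (reg s r <= B)
  | EGet e => fits B d s e
  | EOp o e1 e2 => [&& arithmetic o, fits B d s e1 & fits B d s e2]
  end.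

Lemma fits_wider B d d' s e : d <= d' -> fits B d s e -> fits B d' s e.
Proof.
move=> le_d.
elim: e => //= [r /andP[lt_r ->]|o e1 IH1 e2 IH2 /and3P[-> /IH1-> /IH2->]] //.
by rewrite (leq_trans lt_r le_d).
Qed.

Definition same_below (d : nat) (s s' : state) : Prop :=
  (forall r, r < d -> reg s' r = reg s r) /\
  (forall a i, arr s' a i = arr s a i).

Lemma eval_same_below B d s s' e :
  same_below d s s' -> fits B d s e -> eval s' e = eval s e.
Proof.
move=> [regE arrE]; elim: e => //= [r /andP[/regE->]|e IH /IH->|] //.
by move=> o e1 IH1 e2 IH2 /and3P[_ /IH1-> /IH2->].
Qed.

Lemma fits_same_below B d s s' e :
  same_below d s s' -> fits B d s e -> fits B d s' e.
Proof.
move=> [regE _]; elim: e => //= [r /andP[lt_r]|o e1 IH1 e2 IH2].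
  by rewrite regE // lt_r.
by move=> /and3P[-> /IH1-> /IH2->].
Qed.

(** An operation yields at most twice the product of the bounds on its arguments, and [2 <= B], so
    each node accounts for one more factor [B]. A lookup falls back to [B] whatever its index. *)
Lemma eval_bound B d s e : 1 < B -> (forall i, arr s 0 i <= B) ->
  fits B d s e -> eval s e <= B ^ cost e.
Proof.
move=> B_gt1 arrB; have B_gt0 : 0 < B by lia.
elim: e => /= [c|r /andP[_]|e _ _|o e1 IH1 e2 IH2] //.
- apply: leq_trans (arrB _) _; rewrite expnS.
  by rewrite leq_pmulr // expn_gt0 B_gt0.
- case/and3P=> ar_o /IH1 {}IH1 /IH2 {}IH2; rewrite expnS expnD.
  have x_gt0 : 0 < B ^ cost e1 by rewrite expn_gt0 B_gt0.
  have y_gt0 : 0 < B ^ cost e2 by rewrite expn_gt0 B_gt0.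
  move: (B ^ cost e1) (B ^ cost e2) (eval s e1) (eval s e2) IH1 IH2 x_gt0 y_gt0.
  move=> x y m n le_m le_n x_gt0 y_gt0.
  have le_xy : 2 * (x * y) <= B * (x * y) by rewrite leq_mul2r B_gt1 orbT.
  have le_mn : m * n <= x * y by rewrite leq_mul.
  have le_x : x <= x * y by rewrite leq_pmulr.
  have le_y : y <= x * y by rewrite leq_pmull.
  case: o ar_o => //= _; try lia.
  by apply: leq_trans (leq_div _ _) _; lia.
Qed.

Lemma same_below_trans d s1 s2 s3 :
  same_below d s1 s2 -> same_below d s2 s3 -> same_below d s1 s3.
Proof.
move=> [reg12 arr12] [reg23 arr23]; split=> [r lt_r|a i].
  by rewrite reg23 // reg12.
by rewrite arr23 arr12.
Qed.

Lemma same_belowW d d' s s' :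
  d <= d' -> same_below d' s s' -> same_below d s s'.
Proof. by move=> le_d [regE arrE]; split=> // r lt_r; apply: regE; lia. Qed.

Lemma same_below_set_reg d r s v :
  d <= r -> same_below d s (set_reg s r v).
Proof. by move=> le_d; split=> // x lt_x; rewrite /= upd_other //; lia. Qed.

(** Subexpressions cost less, so the single bound on [B ^ cost e] keeps every intermediate value,
    addresses included, within a word. *)
Lemma compile_runs w B d s e : 1 < B -> (forall i, arr s 0 i <= B) ->
  fits B d s e -> B ^ cost e < 2 ^ w ->
  runs w (compile d e) s (cost e)
    (fun s' => reg s' d = eval s e /\ same_below d s s').
Proof.
move=> B_gt1.
have lt_pow m n : m <= n -> B ^ n < 2 ^ w -> B ^ m < 2 ^ w.
  by move=> le_mn; apply: leq_ltn_trans; rewrite leq_exp2l.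
elim: e d s => [c|r|e IH|o e1 IH1 e2 IH2] d s arrB fit_e lt_w.
- exists 1, (set_reg s d c); split=> //.
    by apply: exec_Const; apply: leq_ltn_trans lt_w; rewrite expn1.
  by split; [exact: upd_same | exact: same_below_set_reg].
- have /andP[lt_r le_r] := fit_e.
  exists 1, (set_reg s d (reg s r)); split=> //.
    by apply: exec_Move; apply: leq_ltn_trans lt_w; rewrite expn1.
  by split; [exact: upd_same | exact: same_below_set_reg].
- rewrite /= -addn1; apply: runs_seq.
    by apply: IH => //; apply: lt_pow lt_w => /=; lia.
  move=> s1 [s1d same1]; exists 1, (set_reg s1 d (arr s1 0 (reg s1 d))); split=> //.
    apply: exec_Read; rewrite s1d; have [_ ->] := same1.
    by apply: leq_ltn_trans lt_w; exact: (@eval_bound B d s (EGet e)).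
  split; first by rewrite /= upd_same s1d; have [_ ->] := same1.
  exact: same_below_trans same1 (same_below_set_reg _ _ _).
- have /and3P[_ fit1 fit2] := fit_e.
  rewrite /= -[(_ + _).+1]addn1 -addnA; apply: runs_seq.
    by apply: IH1 => //; apply: lt_pow lt_w => /=; lia.
  move=> s1 [s1d same1]; apply: runs_seq.
    apply: IH2; first by move=> i; have [_ ->] := same1.
      exact: fits_wider (fits_same_below same1 fit2).
    by apply: lt_pow lt_w => /=; lia.
  move=> s2 [s2d same2].
  have s2E : eval_binop o (reg s2 d) (reg s2 d.+1) = eval s (EOp o e1 e2).
    rewrite s2d (eval_same_below same1 fit2); have [-> //] := same2.
    by rewrite s1d.
  exists 1, (set_reg s2 d (eval s (EOp o e1 e2))); split=> //.
    rewrite -s2E; apply: exec_Op; rewrite s2E.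
    by apply: leq_ltn_trans lt_w; exact: (@eval_bound B d s (EOp o e1 e2)).
  split; first exact: upd_same.
  apply: (same_below_trans same1).
  apply: (same_below_trans (same_belowW (leqnSn d) same2)).
  exact: same_below_set_reg.
Qed.

Definition assign (d r : nat) (e : expr) : cmd := Seq (compile d e) (Move r d).

Definition differ_at (d r : nat) (s s' : state) : Prop :=
  (forall x, x < d -> x != r -> reg s' x = reg s x) /\
  (forall a i, arr s' a i = arr s a i).

Lemma assign_runs w B d r s e : 1 < B -> (forall i, arr s 0 i <= B) ->
  fits B d s e -> B ^ cost e < 2 ^ w ->
  runs w (assign d r e) s (cost e).+1
    (fun s' => reg s' r = eval s e /\ differ_at d r s s').
Proof.
move=> B_gt1 arrB fit_e lt_w; rewrite -addn1; apply: runs_seq.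
  exact: compile_runs fit_e lt_w.
move=> s1 [s1d [reg1 arr1]]; exists 1, (set_reg s1 r (reg s1 d)); split=> //.
  by apply: exec_Move; rewrite s1d; apply: leq_ltn_trans lt_w; apply: eval_bound fit_e.
split; first by rewrite /= upd_same.
by split=> // x lt_x x_r; rewrite /= upd_other // reg1.
Qed.

Definition store (d a : nat) (e1 e2 : expr) : cmd :=
  Seq (compile d e1) (Seq (compile d.+1 e2) (Write a d d.+1)).

Lemma store_runs w B d a s e1 e2 : 1 < B -> (forall i, arr s 0 i <= B) ->
  fits B d s e1 -> fits B d s e2 ->
  B ^ cost e1 < 2 ^ w -> B ^ cost e2 < 2 ^ w ->
  runs w (store d a e1 e2) s (cost e1 + cost e2).+1
    (fun s' => (forall x, x < d -> reg s' x = reg s x) /\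
      forall b i, arr s' b i =
        if (b == a) && (i == eval s e1) then eval s e2 else arr s b i).
Proof.
move=> B_gt1 arrB fit1 fit2 lt1 lt2; rewrite -[(_ + _).+1]addn1 -addnA; apply: runs_seq.
  exact: compile_runs fit1 lt1.
move=> s1 [s1d same1]; apply: runs_seq.
  apply: compile_runs lt2 => //; first by move=> i; have [_ ->] := same1.
  exact: fits_wider (fits_same_below same1 fit2).
move=> s2 [s2d [reg2 arr2]]; exists 1, (set_arr s2 a (reg s2 d) (reg s2 d.+1)).
rewrite (eval_same_below same1 fit2) in s2d; have [reg1 arr1] := same1.
split=> //; first by apply: exec_Write; rewrite s2d;
                     apply: leq_ltn_trans lt2; apply: eval_bound fit2.
split=> [x lt_x|b i]; first by rewrite /= reg2 ?reg1 //; lia.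
rewrite /= s2d reg2 // s1d /upd; case: eqP => [->|_] /=; last by rewrite arr2.
by case: eqP => // _; rewrite arr2.
Qed.

(** * Loops *)

Definition for_loop (i c b : nat) (body : cmd) : cmd :=
  Seq (Const i 0) (Seq (Op Lt c i b)
    (While c (Seq body (Seq (Const c 1) (Seq (Op Add i i c) (Op Lt c i b)))))).

(** The loop control overwrites [i] and [c] between rounds, so the invariant must survive changes to
    them. A round pays for the body, three control instructions and a test; the final 3 pays for two
    initial instructions and the failing test. The counter ends at [m], which must therefore fit in
    a word. *)
Lemma for_loop_runs w i c b body m (I : nat -> state -> Prop) T s :
  0 < w -> i != c -> i != b -> c != b -> m < 2 ^ w -> reg s b = m -> I 0 s ->
  (forall j s s',
     (forall x, x != i -> x != c -> reg s' x = reg s x) ->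
     (forall a x, arr s' a x = arr s a x) -> I j s -> I j s') ->
  (forall j s, j < m -> I j s -> reg s i = j -> reg s b = m ->
     runs w body s T
       (fun s' => [/\ I j.+1 s', reg s' i = j & reg s' b = m])) ->
  runs w (for_loop i c b body) s ((T + 4) * m + 3) (I m).
Proof.
move=> w_gt0 i_c i_b c_b lt_m s_b I0 I_stable I_body.
have w_gt1 : 1 < 2 ^ w by rewrite -(expn0 2) ltn_exp2l.
have [b_i b_c c_i] : [/\ b != i, b != c & c != i] by rewrite !(eq_sym _ i) (eq_sym b).
have loop l : forall j s, j + l = m -> I j s -> reg s i = j -> reg s b = m ->
    reg s c = (j < m) ->
    runs w (While c (Seq body (Seq (Const c 1) (Seq (Op Add i i c) (Op Lt c i b)))))
      s ((T + 4) * l + 1) (I m).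
  elim: l => [|l IH] j s0 jl Ij si sb sc.
    exists 1, s0; split; [|lia|by rewrite -jl addn0].
    by apply: exec_WhileF; rewrite sc; lia.
  have lt_j : j < m by lia.
  have [t [s1 [ex1 le_t [I1 s1i s1b]]]] := I_body _ _ lt_j Ij si sb.
  pose s2 := set_reg s1 c 1.
  pose s3 := set_reg s2 i (eval_binop Add (reg s2 i) (reg s2 c)).
  pose s4 := set_reg s3 c (eval_binop Lt (reg s3 i) (reg s3 b)).
  have s3i : reg s3 i = j.+1.
    by rewrite /s3 /s2 /= !upd_same upd_other // s1i addn1.
  have s3b : reg s3 b = m by rewrite /s3 /s2 /= !upd_other.
  have [u [s5 [ex5 le_u I5]]] : runs w
      (While c (Seq body (Seq (Const c 1) (Seq (Op Add i i c) (Op Lt c i b)))))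
      s4 ((T + 4) * l + 1) (I m).
    apply: (IH j.+1); first lia.
    - by apply: I_stable I1 => // x x_i x_c; rewrite /s4 /s3 /s2 /= !upd_other.
    - by rewrite /s4 /= upd_other.
    - by rewrite /s4 /= upd_other.
    - by rewrite -s3i -[in RHS]s3b; exact: upd_same.
  exists ((t + (1 + (1 + 1))) + u).+1, s5; split=> //; last by rewrite mulnS; lia.
  apply: exec_WhileT ex5; first by rewrite sc lt_j.
  apply: (exec_Seq ex1); apply: exec_Seq; first exact: exec_Const.
  apply: exec_Seq.
    apply: exec_Op; rewrite -[eval_binop _ _ _](upd_same (reg s2) i).
    by rewrite [X in X < _]s3i; lia.
  by apply: exec_Op; exact: leq_ltn_trans (leq_b1 _) w_gt1.
pose s1 := set_reg s i 0.
pose s2 := set_reg s1 c (eval_binop Lt (reg s1 i) (reg s1 b)).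
have [t [s3 [ex3 le_t I3]]] : runs w
    (While c (Seq body (Seq (Const c 1) (Seq (Op Add i i c) (Op Lt c i b)))))
    s2 ((T + 4) * m + 1) (I m).
  apply: (loop m 0) => //.
  - by apply: I_stable I0 => // x x_i x_c; rewrite /s2 /s1 /= !upd_other.
  - by rewrite /s2 /s1 /= upd_other // upd_same.
  - by rewrite /s2 /s1 /= !upd_other.
  - by rewrite /s2 /= upd_same /s1 /= upd_same upd_other // s_b.
exists (1 + (1 + t)), s3; split=> //; last lia.
apply: exec_Seq; first by apply: exec_Const; lia.
apply: exec_Seq ex3; apply: exec_Op; exact: leq_ltn_trans (leq_b1 _) w_gt1.
Qed.

(** * Running a program in a fresh region of memory *)

Fixpoint reg_bound (p : cmd) : nat :=
  match p with
  | Const r _ => r.+1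
  | Move r x => maxn r.+1 x.+1
  | Op _ r x y => maxn r.+1 (maxn x.+1 y.+1)
  | Read r _ x => maxn r.+1 x.+1
  | Write _ x y => maxn x.+1 y.+1
  | Seq p q => maxn (reg_bound p) (reg_bound q)
  | If x p q => maxn x.+1 (maxn (reg_bound p) (reg_bound q))
  | While x p => maxn x.+1 (reg_bound p)
  end.

(* Registers move up by [K], arrays by one, and addresses by the contents of
   register [b]; register [d] holds the shifted address. *)
Fixpoint relocate (K d b : nat) (p : cmd) : cmd :=
  match p with
  | Const r c => Const (K + r) c
  | Move r x => Move (K + r) (K + x)
  | Op o r x y => Op o (K + r) (K + x) (K + y)
  | Read r a x => Seq (Op Add d b (K + x)) (Read (K + r) a.+1 d)
  | Write a x y => Seq (Op Add d b (K + x)) (Write a.+1 d (K + y))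
  | Seq p q => Seq (relocate K d b p) (relocate K d b q)
  | If x p q => If (K + x) (relocate K d b p) (relocate K d b q)
  | While x p => While (K + x) (relocate K d b p)
  end.

(** The bound on register contents keeps every shifted address inside the region of [2 ^ w] cells
    from [base] on. *)
Definition simulates (K m w base : nat) (s s' : state) : Prop :=
  [/\ forall r, r < m -> reg s' (K + r) = reg s r,
      forall r, r < m -> reg s r < 2 ^ w
    & forall a i, i < 2 ^ w -> arr s' a.+1 (base + i) = arr s a i].

(** What the surrounding program relies on: its own registers, the input array, and the memory of
    later rounds, which has to remain zero. *)
Definition outside_unchanged (K top : nat) (s s' : state) : Prop :=
  [/\ forall r, r < K -> reg s' r = reg s r,
      forall i, arr s' 0 i = arr s 0 i
    & forall a i, top <= i -> arr s' a i = arr s a i].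

Lemma outside_unchanged_trans K top s1 s2 s3 :
  outside_unchanged K top s1 s2 -> outside_unchanged K top s2 s3 ->
  outside_unchanged K top s1 s3.
Proof.
move=> [r12 z12 a12] [r23 z23 a23]; split=> [r ltr|i|a i lti].
- by rewrite r23 // r12.
- by rewrite z23 z12.
- by rewrite a23 // a12.
Qed.

Lemma outside_unchanged_set_reg K top s r v :
  K <= r -> outside_unchanged K top s (set_reg s r v).
Proof. by move=> le_r; split=> // x lt_x; rewrite /= upd_other //; lia. Qed.

Section Relocate.

Variables (K m w1 w base b : nat).
Hypothesis b_lt : b < K.
Hypothesis region_lt : base + 2 ^ w1 <= 2 ^ w.

Let d := K + m.
Let sim := simulates K m w1 base.
Let unchanged := outside_unchanged K (base + 2 ^ w1).

Lemma simulates_set_reg s s' r v :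
  v < 2 ^ w1 -> sim s s' -> sim (set_reg s r v) (set_reg s' (K + r) v).
Proof.
move=> lt_v [regE reg_lt arrE]; split=> //= x lt_x.
  by rewrite /upd eqn_add2l; case: eqP => // _; exact: regE.
by rewrite /upd; case: eqP => // _; exact: reg_lt.
Qed.

Lemma simulates_address s s' x : x < m -> sim s s' -> reg s' b = base ->
  let s1 := set_reg s' d (base + reg s x) in
  [/\ exec w (Op Add d b (K + x)) s' 1 s1, sim s s1, unchanged s' s1
    & reg s1 d = base + reg s x].
Proof.
move=> lt_x [regE reg_lt arrE] s'b s1.
have vE : eval_binop Add (reg s' b) (reg s' (K + x)) = base + reg s x.
  by rewrite /= s'b regE.
split.
- rewrite /s1 -vE; apply: exec_Op; rewrite vE.
  by apply: leq_trans region_lt; rewrite ltn_add2l reg_lt.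
- by split=> //= r lt_r; rewrite upd_other ?regE // /d; lia.
- by apply: outside_unchanged_set_reg; rewrite leq_addr.
- exact: upd_same.
Qed.

(** By induction on the run. Only reads and writes gain an instruction, the address computation,
    whence the factor 2. Values of the original run are below [2 ^ w1], so shifted addresses stay
    below [base + 2 ^ w1] and fit in a [w]-bit word. *)
Lemma relocate_runs p s t s1 s' :
  exec w1 p s t s1 -> reg_bound p <= m -> sim s s' -> reg s' b = base ->
  runs w (relocate K d b p) s' (2 * t) (fun s1' => sim s1 s1' /\ unchanged s' s1').
Proof.
have w1_lt v : v < 2 ^ w1 -> v < 2 ^ w by lia.
have step v (q : cmd) s0 s0' r : v < 2 ^ w1 -> sim s0 s0' ->
    exec w q s0' 1 (set_reg s0' (K + r) v) ->
    runs w q s0' 2 (fun s1' => sim (set_reg s0 r v) s1' /\ unchanged s0' s1').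
  move=> lt_v sim0 ex; exists 1, (set_reg s0' (K + r) v); split=> //.
  split; first exact: simulates_set_reg.
  by apply: outside_unchanged_set_reg; rewrite leq_addr.
move=> ex; elim: ex s' => {p s t s1} /=.
- move=> r c s lt_c s' _ sim_s s'b; apply: step => //.
  by apply: exec_Const; apply: w1_lt.
- move=> r x s lt_x s' le_m sim_s s'b; apply: step => //.
  have [regE _ _] := sim_s; rewrite -regE; last lia.
  by apply: exec_Move; rewrite regE ?w1_lt //; lia.
- move=> o r x y s lt_v s' le_m sim_s s'b; apply: step => //.
  have [regE _ _] := sim_s.
  rewrite -(regE x) -?(regE y); [|lia..].
  by apply: exec_Op; rewrite !regE ?w1_lt //; lia.
- move=> r a x s lt_v s' le_m sim_s s'b.
  have lt_x : x < m by lia.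
  have [ex1 sim1 un1 s1d] := simulates_address lt_x sim_s s'b.
  set s1 := set_reg s' d _ in ex1 sim1 un1 s1d.
  have [regE reg_lt arrE] := sim1.
  exists 2, (set_reg s1 (K + r) (arr s a (reg s x))); split=> //.
    rewrite -(addn1 1); apply: exec_Seq ex1 _.
    rewrite -arrE ?reg_lt // -s1d; apply: exec_Read.
    by rewrite s1d arrE ?reg_lt // w1_lt.
  split; first exact: simulates_set_reg.
  apply: outside_unchanged_trans un1 _.
  by apply: outside_unchanged_set_reg; rewrite leq_addr.
- move=> a x y s lt_v s' le_m sim_s s'b.
  have lt_x : x < m by lia.
  have lt_y : y < m by lia.
  have [ex1 sim1 un1 s1d] := simulates_address lt_x sim_s s'b.
  set s1 := set_reg s' d _ in ex1 sim1 un1 s1d.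
  have [regE reg_lt arrE] := sim1.
  exists 2, (set_arr s1 a.+1 (reg s1 d) (reg s1 (K + y))); split=> //.
    rewrite -(addn1 1); apply: exec_Seq ex1 _; apply: exec_Write.
    by rewrite regE ?w1_lt.
  rewrite s1d regE //; split.
    split=> //= c i lt_i; rewrite /upd eqSS; case: (c =P a) => [_|_]; last exact: arrE.
    by rewrite eqn_add2l; case: eqP => // _; exact: arrE.
  apply: outside_unchanged_trans un1 _; split=> //= c i le_i.
  rewrite /upd; case: eqP => // ->; case: eqP => // iE.
  by have := reg_lt _ lt_x; lia.
- move=> p q s t s1 u s2 _ IHp _ IHq s' le_m sim_s s'b; rewrite mulnDr.
  apply: runs_seq; first by apply: IHp => //; lia.
  move=> s1' [sim1 un1]; have [un1r _ _] := un1.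
  apply: (runs_weaken (IHq s1' _ sim1 _)) => //; [lia|by rewrite un1r|].
  by move=> s2' [? un2]; split=> //; exact: outside_unchanged_trans un1 un2.
- move=> x p q s t s1 s_x _ IHp s' le_m sim_s s'b.
  have [|u [s2 [ex2 le_u Q2]]] := IHp s' _ sim_s s'b; first lia.
  exists u.+1, s2; split=> //; last lia.
  by apply: exec_IfT => //; have [regE _ _] := sim_s; rewrite regE //; lia.
- move=> x p q s t s1 s_x _ IHp s' le_m sim_s s'b.
  have [|u [s2 [ex2 le_u Q2]]] := IHp s' _ sim_s s'b; first lia.
  exists u.+1, s2; split=> //; last lia.
  by apply: exec_IfF => //; have [regE _ _] := sim_s; rewrite regE //; lia.
- move=> x p s t s1 u s2 s_x _ IHp _ IHq s' le_m sim_s s'b.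
  have [|v [s3 [ex3 le_v [sim3 un3]]]] := IHp s' _ sim_s s'b; first lia.
  have [un3r _ _] := un3.
  have [||v' [s4 [ex4 le_v' [sim4 un4]]]] := IHq s3 _ sim3 _ => //.
    by rewrite un3r.
  exists (v + v').+1, s4; split; [|lia|].
    by apply: exec_WhileT ex3 ex4; have [regE _ _] := sim_s; rewrite regE //; lia.
  by split=> //; exact: outside_unchanged_trans un3 un4.
- move=> x p s s_x s' le_m sim_s s'b.
  exists 1, s'; split=> //.
  by apply: exec_WhileF; have [regE _ _] := sim_s; rewrite regE //; lia.
Qed.

End Relocate.

Fixpoint clear (K m : nat) : cmd :=
  if m is m'.+1 then Seq (clear K m') (Const (K + m') 0) else Const K 0.

Lemma clear_runs w K m s : 0 < m ->
  runs w (clear K m) s m.+1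
    (fun s' => [/\ forall r, r < m -> reg s' (K + r) = 0,
                   forall r, r < K -> reg s' r = reg s r
                 & forall a i, arr s' a i = arr s a i]).
Proof.
case: m => // m _.
elim: m => [|m IH].
  rewrite /= -(addn1 1); apply: runs_seq.
    by exists 1, (set_reg s K 0); split; [apply: exec_Const; rewrite expn_gt0|
      | exact: (erefl (set_reg s K 0))].
  move=> _ <-; exists 1, (set_reg (set_reg s K 0) (K + 0) 0); split=> //.
    by apply: exec_Const; rewrite expn_gt0.
  split=> // r lt_r; last by rewrite /= !upd_other //; lia.
  by have -> : r = 0 by [lia]; exact: upd_same.
rewrite -[_.+3]addn1; apply: (runs_seq IH).
move=> s1 [z1 r1 a1]; exists 1, (set_reg s1 (K + m.+1) 0); split=> //.
  by apply: exec_Const; rewrite expn_gt0.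
split=> // r lt_r; last by rewrite /= upd_other ?r1 //; lia.
rewrite /= /upd eqn_add2l; case: eqP => // r_m; apply: z1; lia.
Qed.

(** * The reduction as a program *)

Definition esum (es : seq expr) : expr := foldr (EOp Add) (EConst 0) es.

Definition epow (e : expr) (l : nat) : expr := iter l (EOp Mul e) (EConst 1).

(** Truth values are 0 and 1: conjunction is a product, and negation is comparison with 0. *)
Definition eabsent (e : expr) (es : seq expr) : expr :=
  foldr (fun e' => EOp Mul (EOp Eq (EOp Eq e e') (EConst 0))) (EConst 1) es.

Fixpoint euniq (es : seq expr) : expr :=
  if es is e :: es' then EOp Mul (eabsent e es') (euniq es') else EConst 1.

Lemma eval_esum s es : eval s (esum es) = sumn (map (eval s) es).
Proof. by elim: es => //= e es ->. Qed.

Lemma eval_epow s e l : eval s (epow e l) = eval s e ^ l.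
Proof. by elim: l => //= l ->; rewrite expnS. Qed.

Lemma eval_eabsent s e es :
  eval s (eabsent e es) = (eval s e \notin map (eval s) es).
Proof.
by elim: es => //= e' es ->; rewrite inE negb_or eqb0 mulnb.
Qed.

Lemma eval_euniq s es : eval s (euniq es) = uniq (map (eval s) es).
Proof. by elim: es => //= e es ->; rewrite eval_eabsent mulnb. Qed.

Lemma fits_esum B d s es : all (fits B d s) es -> fits B d s (esum es).
Proof. by elim: es => //= e es IH /andP[-> /IH->]. Qed.

Lemma fits_epow B d s e l : 0 < B -> fits B d s e -> fits B d s (epow e l).
Proof. by move=> B_gt0 fit_e; elim: l => //= l ->; rewrite fit_e. Qed.

Lemma fits_euniq B d s es : 0 < B -> all (fits B d s) es -> fits B d s (euniq es).
Proof.
move=> B_gt0; elim: es => //= e es IH /andP[fit_e fit_es]; rewrite IH // andbT.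
by elim: es fit_es {IH} => //= e' es IH /andP[-> /IH->]; rewrite fit_e.
Qed.

(** Vertex [u] stands for the digit [u %% n] in part [u %/ n]. For [k - 1] vertices in distinct
    parts, [i] is the part that is missing, found as a difference of sums, and the number looked up
    is the [i]-th term, y + i + \sum_j (i - j) v_j n^j. Its negative contributions are collected in
    [shift], since subtraction is truncated. Only sums over [us] occur, besides distinctness of the
    parts, so the order of [us] does not matter. *)
Definition edge_test (k n y : nat) (mem : nat -> bool) (us : seq nat) : bool :=
  let parts := [seq u %/ n | u <- us] in
  let i := sumn (iota 0 k) - sumn parts in
  let shift := sumn [seq u %/ n * (u %% n * n ^ (u %/ n)) | u <- us] in
  let top := y + i + i * sumn [seq u %% n * n ^ (u %/ n) | u <- us] in
  [&& uniq parts, shift <= top & mem (top - shift)].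

Definition base_digits (b h j : nat) : seq nat :=
  [seq j %/ b ^ l %% b | l <- iota 0 h].

(* Register usage: 0 holds the size [N], 1 the part size [n], 2 the number [V]
   of vertices, 3 the table size [V ^ h], 4 the spacing of the memory regions,
   5 the number of rounds, 6 the round [y], 7 a table index, 8 the number of
   positive answers, 9 the base address, 10 loop tests; the relocated program
   uses registers from 11 on. *)
Section Program.

Variables (k h c : nat) (p : cmd).

Definition esize : expr :=
  EOp Add (EReg 1) (EOp Lt (epow (EReg 1) k) (EReg 0)).
Definition evertices : expr := EOp Mul (EConst k) (EReg 1).
Definition etable : expr := epow (EReg 2) h.
Definition espacing : expr := epow (EOp Mul (EConst 2) (EReg 2)) c.
Definition erounds : expr :=
  EOp Add (EOp Add (EReg 0) (EOp Mul (EConst k) (epow (EReg 1) k))) (EConst 1).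
Definition ebase : expr := EOp Mul (EReg 6) (EReg 4).
Definition eaddress : expr := EOp Add (EReg 9) (EReg 7).
Definition eanswer : expr := EOp Add (EReg 8) (EOp Lt (EConst 0) (EReg 11)).

Definition edigit (l : nat) : expr :=
  EOp Mod (EOp Div (EReg 7) (epow (EReg 2) l)) (EReg 2).
Definition epart (l : nat) : expr := EOp Div (edigit l) (EReg 1).
(* [n ^ epart l], as a sum over the possible values of the exponent. *)
Definition eweight (l : nat) : expr :=
  esum [seq EOp Mul (EOp Eq (epart l) (EConst q)) (epow (EReg 1) q) | q <- iota 0 k].
Definition eterm (l : nat) : expr :=
  EOp Mul (EOp Mod (edigit l) (EReg 1)) (eweight l).
Definition emissing : expr :=
  EOp Defs.Sub (EConst (sumn (iota 0 k))) (esum [seq epart l | l <- iota 0 h]).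
Definition eshift : expr :=
  esum [seq EOp Mul (epart l) (eterm l) | l <- iota 0 h].
Definition etop : expr :=
  EOp Add (EOp Add (EReg 6) emissing)
    (EOp Mul emissing (esum [seq eterm l | l <- iota 0 h])).
(** There is no short circuit: the lookup takes place even when the shift exceeds the top. The
    truncated difference is then still a legal address, and the factor 0 discards the result. *)
Definition etest : expr :=
  EOp Mul (euniq [seq epart l | l <- iota 0 h])
    (EOp Mul (EOp Lt eshift (EOp Add etop (EConst 1)))
       (EGet (EOp Defs.Sub etop eshift))).

(** Collected so that one bound, on [B ^ max_cost], covers every expression that gets compiled;
    [cost_lt] refers to the entries by position. *)
Definition exprs : seq expr :=
  [:: EConst 1; esize; evertices; etable; espacing; erounds; ebase; eaddress;
      eanswer; etest].

Definition max_cost : nat := \max_(e <- exprs) cost e.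

Let m := (reg_bound p).+1.
Let d := 11 + m.

Definition fill_table : cmd := for_loop 7 10 3 (store d 1 eaddress etest).

(** Register 11 and array 1 are register 0 and array 0 of the relocated program, where it expects
    the number of vertices and the adjacency tensor, and where it leaves its answer in register
    11. *)
Definition round : cmd :=
  Seq (assign d 9 ebase) (Seq fill_table
    (Seq (clear 11 m) (Seq (Move 11 2)
      (Seq (relocate 11 d 9 p) (assign d 8 eanswer))))).

Definition reduction : cmd :=
  Seq (assign d 1 (EConst 1)) (Seq (for_loop 6 10 0 (assign d 1 esize))
    (Seq (assign d 2 evertices) (Seq (assign d 3 etable)
      (Seq (assign d 4 espacing) (Seq (assign d 5 erounds)
        (Seq (for_loop 6 10 5 round) (Move 0 8))))))).

Definition fill_time (M : nat) : nat :=
  ((cost eaddress + cost etest).+1 + 4) * M + 3.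

Definition round_time (M T : nat) : nat :=
  (cost ebase).+1 + (fill_time M + (m.+1 + (1 + (2 * T + (cost eanswer).+1)))).

Definition reduction_time (N M Y T : nat) : nat :=
  2 + (((cost esize).+1 + 4) * N + 3 + ((cost evertices).+1 + ((cost etable).+1 +
    ((cost espacing).+1 + ((cost erounds).+1 +
      ((round_time M T + 4) * Y + 3 + 1)))))).

(** For [k > 0] this is the least [n >= 1] with [n ^ k >= N]: the search stalls once the bound
    holds. Its O(N) steps are affordable. *)
Definition part_size (N : nat) : nat := iter N (fun n => n + (n ^ k < N)) 1.

Variables (N B w : nat) (mem : nat -> bool).

Let n := part_size N.
Let V := k * n.
Let M := V ^ h.
Let S := (2 * V) ^ c.
Let Y := N + k * n ^ k + 1.
Let w1 := c * bits V.

Hypothesis k_gt0 : 0 < k.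
Hypothesis c_gt0 : 0 < c.
Hypothesis h_le_c : h <= c.
Hypothesis B_large :
  [/\ 1 < B, k <= B, sumn (iota 0 k) <= B
    & [/\ N <= B, n <= B, V <= B, M <= B & Y * S <= B]].
Hypothesis w_large : B ^ max_cost < 2 ^ w.

Variable input : nat -> nat -> nat.
Variable answer : nat -> Prop.
Variable T : nat.

Hypothesis inputE : forall y j,
  input y j = (j < M) && edge_test k n y mem (base_digits V h j).
Hypothesis p_correct : forall y, y < Y -> exists t s,
  [/\ exec w1 p (init V (input y)) t s, t <= T & answer y <-> reg s 0 <> 0].

(** * Numerical bounds on the parameters of a round *)

Lemma part_size_gt0 N' : 0 < part_size N'.
Proof.
rewrite /part_size; elim: {1}N' => //= i IH; exact: leq_trans IH (leq_addr _ _).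
Qed.

Lemma V_gt0 : 0 < V.
Proof. by rewrite muln_gt0 k_gt0 part_size_gt0. Qed.

(** [bits V] exceeds the integer part of log_2 V by one, so [2 ^ bits V <= 2 * V]. A region thus
    contains all addresses of a run. *)
Lemma S_large : 2 ^ w1 <= S.
Proof.
rewrite /w1 mulnC expnM /S leq_exp2r // /bits expnS leq_mul2l /=.
by apply: trunc_logP => //; exact: V_gt0.
Qed.

Lemma V_lt : V < 2 ^ w1.
Proof.
apply: leq_trans (trunc_log_ltn V (ltnSn 1)) _.
by rewrite leq_exp2l // /w1 /bits leq_pmull.
Qed.

(** The table of one round thus ends before the region of the next one begins. *)
Lemma M_le_S : M <= S.
Proof.
apply: (@leq_trans (V ^ c)); first by rewrite leq_pexp2l ?V_gt0.
by rewrite leq_exp2r // leq_pmull.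
Qed.

Lemma S_gt0 : 0 < S. Proof. by apply: leq_trans S_large; rewrite expn_gt0. Qed.

Lemma Y_le : Y <= B.
Proof.
by case: B_large => _ _ _ [_ _ _ _]; apply: leq_trans; rewrite leq_pmulr ?S_gt0.
Qed.

Lemma cost_lt i :
  i < size exprs -> B ^ cost (nth (EConst 0) exprs i) < 2 ^ w.
Proof.
move=> lt_i; apply: leq_ltn_trans w_large; case: B_large => B_gt1 _ _ _.
rewrite leq_exp2l // /max_cost (big_nth (EConst 0)) big_mkord.
exact: (leq_bigmax (Ordinal lt_i)).
Qed.


(** * Values of the compiled expressions *)

Definition constants (s : state) : Prop :=
  [/\ reg s 0 = N, reg s 1 = n, reg s 2 = V, reg s 3 = M
    & [/\ reg s 4 = S, reg s 5 = Y & forall i, arr s 0 i = mem i]].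

Lemma constants_same s s' :
  (forall r, r < 6 -> reg s' r = reg s r) -> (forall i, arr s' 0 i = arr s 0 i) ->
  constants s -> constants s'.
Proof.
by move=> regE arrE [r0 r1 r2 r3 [r4 r5 mems]]; do ![split] => *; rewrite ?regE ?arrE.
Qed.

Lemma mem_le (b : bool) : b <= B.
Proof. by case: B_large => B_gt1 _ _ _; apply: leq_trans (leq_b1 b) (ltnW B_gt1). Qed.

Lemma sum_weights a x : x < k ->
  sumn [seq (x == q) * a ^ q | q <- iota 0 k] = a ^ x.
Proof.
move=> lt_x; have : x \in iota 0 k by rewrite mem_iota.
elim: (iota 0 k) (iota_uniq 0 k) => //= q s IH /andP[q_s /IH{}IH].
rewrite inE; case: eqP => [->|_ /IH->] /=; last by rewrite mul0n.
move=> _; rewrite mul1n.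
suff -> : sumn [seq (q == q') * a ^ q' | q' <- s] = 0 by rewrite addn0.
elim: s q_s {IH} => //= q' s IH; rewrite inE negb_or => /andP[/negbTE-> /IH->].
by rewrite mul0n.
Qed.

Lemma eval_epart s l : constants s ->
  eval s (epart l) = reg s 7 %/ V ^ l %% V %/ n.
Proof. by move=> [_ r1 r2 _ _]; rewrite /= eval_epow /= r1 r2. Qed.

Lemma eval_eterm s l : constants s ->
  eval s (eterm l) =
    let u := reg s 7 %/ V ^ l %% V in u %% n * n ^ (u %/ n).
Proof.
move=> cs; have [_ r1 r2 _ _] := cs; have partE := eval_epart l cs.
rewrite /eterm [LHS]/= eval_epow /= r1 r2; congr (_ * _).
rewrite /eweight eval_esum -map_comp.
rewrite -(@sum_weights _ (reg s 7 %/ V ^ l %% V %/ n)); last first.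
  by rewrite ltn_divLR ?part_size_gt0 // ltn_mod V_gt0.
congr sumn; apply: eq_map => q.
rewrite -[LHS]/((eval s (epart l) == q) * eval s (epow (EReg 1) q)).
by rewrite partE eval_epow /= r1.
Qed.

Lemma eval_etest s : constants s ->
  eval s etest = edge_test k n (reg s 6) mem (base_digits V h (reg s 7)).
Proof.
move=> cs; have [_ _ _ _ [_ _ mems]] := cs.
have partsE : [seq eval s e | e <- [seq epart l | l <- iota 0 h]] =
    [seq u %/ n | u <- base_digits V h (reg s 7)].
  by rewrite -!map_comp; apply: eq_map => l; exact: eval_epart.
have termsE : [seq eval s e | e <- [seq eterm l | l <- iota 0 h]] =
    [seq u %% n * n ^ (u %/ n) | u <- base_digits V h (reg s 7)].
  by rewrite -!map_comp; apply: eq_map => l; exact: eval_eterm.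
have shiftE : eval s eshift =
    sumn [seq u %/ n * (u %% n * n ^ (u %/ n)) | u <- base_digits V h (reg s 7)].
  rewrite /eshift eval_esum -!map_comp; congr sumn; apply: eq_map => l.
  rewrite -[LHS]/(eval s (epart l) * eval s (eterm l)).
  by rewrite eval_epart // eval_eterm.
have missingE : eval s emissing =
    sumn (iota 0 k) - sumn [seq u %/ n | u <- base_digits V h (reg s 7)].
  rewrite -[LHS]/(_ - eval s (esum [seq epart l | l <- iota 0 h])).
  by rewrite eval_esum partsE.
have topE : eval s etop = let i := eval s emissing in
    reg s 6 + i + i * sumn [seq u %% n * n ^ (u %/ n) | u <- base_digits V h (reg s 7)].
  rewrite -[LHS]/(reg s 6 + eval s emissing +
    eval s emissing * eval s (esum [seq eterm l | l <- iota 0 h])).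
  by rewrite eval_esum termsE.
rewrite -[LHS]/(eval s (euniq [seq epart l | l <- iota 0 h]) *
  ((eval s eshift < eval s etop + 1) * arr s 0 (eval s etop - eval s eshift))).
rewrite eval_euniq partsE mems addn1 ltnS topE missingE shiftE /=.
by rewrite !mulnb.
Qed.

Lemma fits_etest s : constants s -> reg s 6 <= B -> reg s 7 <= B -> fits B d s etest.
Proof.
move=> [_ r1 r2 _ _] r6 r7; case: B_large => B_gt1 k_le sum_le [_ n_le V_le _ _].
have B_gt0 : 0 < B by lia.
have reg_fits r : r < 11 -> reg s r <= B -> fits B d s (EReg r).
  by move=> lt_r /= ->; rewrite /d andbT; lia.
have f1 : fits B d s (EReg 1) by apply: reg_fits => //; rewrite r1.
have f2 : fits B d s (EReg 2) by apply: reg_fits => //; rewrite r2.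
have f6 : fits B d s (EReg 6) by apply: reg_fits.
have f7 : fits B d s (EReg 7) by apply: reg_fits.
have fop o e1 e2 : arithmetic o -> fits B d s e1 -> fits B d s e2 ->
    fits B d s (EOp o e1 e2) by move=> /= -> -> ->.
have fsum (f : nat -> expr) (l : nat) : (forall q, q < l -> fits B d s (f q)) ->
    fits B d s (esum [seq f q | q <- iota 0 l]).
  move=> fit_f; apply: fits_esum; rewrite all_map; apply/allP => q.
  by rewrite mem_iota => /andP[_ lt_q]; exact: fit_f.
have fdigit l : fits B d s (edigit l).
  by apply: (fop) => //; apply: (fop) => //; exact: fits_epow.
have fpart l : fits B d s (epart l) by apply: (fop).
have fterm l : fits B d s (eterm l).
  apply: (fop) => //; first exact: (fop).
  apply: fsum => q lt_q; apply: (fop) => //; last exact: fits_epow.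
  by apply: (fop) => //; exact: leq_trans (ltnW lt_q) k_le.
have fmissing : fits B d s emissing by apply: (fop) => //; exact: fsum.
have fshift : fits B d s eshift by apply: fsum => q _; exact: (fop).
have ftop : fits B d s etop.
  by apply: (fop) => //; apply: (fop) => //; apply: fsum.
apply: (fop) => //.
  by apply: fits_euniq => //; rewrite all_map; apply/allP => q _; exact: fpart.
apply: (fop) => //; last exact: (fop Defs.Sub etop eshift isT ftop fshift).
by apply: (fop) => //; exact: (fop).
Qed.

Lemma arr_le s : constants s -> forall i, arr s 0 i <= B.
Proof. by move=> [_ _ _ _ [_ _ mems]] i; rewrite mems mem_le. Qed.

Lemma B_gt1 : 1 < B. Proof. by case: B_large. Qed.

Lemma w_gt0 : 0 < w.
Proof.
case: w w_large => //; rewrite expn0 ltnS leqn0 expn_eq0 => /andP[/eqP B0 _].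
by have := B_gt1; rewrite B0.
Qed.

Lemma B_lt : B < 2 ^ w.
Proof. by have := @cost_lt 0 isT; rewrite /= expn1. Qed.

Lemma round_base_le y : y < Y -> y * S + S <= B.
Proof.
case: B_large => _ _ _ [_ _ _ _ le_B] lt_y; apply: leq_trans le_B.
by rewrite -mulSnr leq_mul2r lt_y orbT.
Qed.

(** Array 0 holds the given set; the relocated program works on the arrays from 1 on. *)
Definition fresh (z : nat) (s : state) : Prop :=
  forall a i, z <= i -> arr s a.+1 i = 0.

Lemma fill_table_runs s y : constants s -> reg s 6 = y -> y < Y ->
  reg s 9 = y * S -> fresh (y * S) s ->
  runs w fill_table s (fill_time M) (fun s' =>
    [/\ forall r, r < 10 -> r != 7 -> reg s' r = reg s r,
        forall i, arr s' 0 i = arr s 0 i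
      & forall a i, arr s' a.+1 (y * S + i) = (a == 0) * input y i]).
Proof.
move=> cs s6 lt_y s9 fr; have [r0 r1 r2 r3 [r4 r5 mems]] := cs.
have [_ _ _ [_ _ _ M_le _]] := B_large; have base_le := round_base_le lt_y.
pose tst j := edge_test k n y mem (base_digits V h j).
(* The third clause covers all [i]: cells not yet written are zero by freshness, which is also what
   the encoding prescribes from [M] on. *)
pose I j s' := [/\ forall r, r < 10 -> r != 7 -> reg s' r = reg s r,
  forall i, arr s' 0 i = arr s 0 i
  & forall a i, arr s' a.+1 (y * S + i) = [&& a == 0, i < j & tst i]].
apply: (@runs_weaken _ _ _ (fill_time M) _ (I M)) => //; last first.
  move=> s' [regE zeroE tabE]; split=> // a i.
  by rewrite tabE inputE -mulnb.
apply: for_loop_runs; rewrite ?r3 //; first exact: w_gt0.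
- exact: leq_ltn_trans M_le B_lt.
- split=> // a i; rewrite ltn0 andbF; apply: fr; exact: leq_addr.
- move=> j s1 s2 regE arrE [reg1 zero1 tab1]; split=> [r lt_r r7|i|a i].
  + by rewrite regE ?reg1 //; lia.
  + by rewrite arrE.
  + by rewrite arrE.
- move=> j s1 lt_j [reg1 zero1 tab1] s1_7 _.
  have cs1 : constants s1.
    by apply: constants_same cs => // r lt_r; apply: reg1; lia.
  have s1_6 : reg s1 6 = y by rewrite reg1.
  have s1_9 : reg s1 9 = y * S by rewrite reg1.
  have j_le : j <= B by lia.
  have y_le : y <= B by have := Y_le; lia.
  apply: runs_weaken.
  + apply: (store_runs _ B_gt1 (arr_le cs1) _ _ (@cost_lt 7 isT) (@cost_lt 9 isT)).
      by rewrite /= s1_9 s1_7 /d; lia.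
    by apply: fits_etest => //; rewrite ?s1_6 ?s1_7.
  + by [].
  + move=> s2 [reg2 arr2].
    split; [|by rewrite reg2 // s1_7|by rewrite reg2 // reg1].
    split=> [r lt_r r7|i|a i]; first by rewrite reg2 ?reg1 // /d; lia.
      by rewrite arr2 /= zero1.
    rewrite arr2 eval_etest // s1_6 s1_7 /= s1_9 s1_7 eqn_add2l eqSS tab1.
    rewrite ltnS [i <= j]leq_eqVlt; case: (a =P 0) => //= _.
    by case: (i =P j) => [->|_].
Qed.

(** Positive answers are counted; the bound [y] on the counter keeps it within a word. *)
Definition round_invariant (y : nat) (s : state) : Prop :=
  [/\ constants s, reg s 8 <= y, fresh (y * S) s
    & reg s 8 <> 0 <-> exists2 y', y' < y & answer y'].

Lemma round_runs s y : y < Y -> round_invariant y s -> reg s 6 = y ->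
  runs w round s (round_time M T) (fun s' => round_invariant y.+1 s' /\ reg s' 6 = y).
Proof.
move=> lt_y [cs s8 fr ansE] s6; have [r0 r1 r2 r3 [r4 r5 mems]] := cs.
have [_ _ _ [_ _ V_le M_le _]] := B_large; have base_le := round_base_le lt_y.
have y_le : y <= B by have := Y_le; lia.
have S_le : S <= B by lia.
have [t [sp [ex_p le_t sp0]]] := p_correct lt_y.
apply: runs_seq.
  apply: (assign_runs _ B_gt1 (arr_le cs) _ (@cost_lt 6 isT)).
  by rewrite /= s6 r4 /d; lia.
move=> s1 [s1_9]; rewrite /= s6 r4 in s1_9 * => -[reg1 arr1].
have cs1 : constants s1.
  by apply: constants_same cs => // r lt_r; apply: reg1; rewrite /d; lia.
apply: runs_seq.
  apply: (fill_table_runs cs1 _ lt_y s1_9); first by rewrite reg1.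
  by move=> a i le_i; rewrite arr1; exact: fr.
move=> s2 [reg2 zero2 tab2]; apply: (runs_seq (@clear_runs w 11 m s2 isT)).
move=> s3 [clear3 reg3 arr3].
have s3_2 : reg s3 2 = V by rewrite reg3 // reg2 // reg1.
pose s4 := set_reg s3 11 V.
apply: (@runs_seq _ _ _ _ _ _ (eq s4)).
  exists 1, s4; split=> //; rewrite /s4 -s3_2; apply: exec_Move.
  by rewrite s3_2; exact: leq_ltn_trans V_le B_lt.
move=> _ <-.
have reg4 r : r < 10 -> r != 7 -> r != 9 -> reg s4 r = reg s r.
  by move=> lt_r r7 r9; rewrite /= upd_other ?reg3 ?reg2 ?reg1 // /d; lia.
have s4_9 : reg s4 9 = y * S by rewrite /= upd_other // reg3 // reg2.
have arr4 a i : arr s4 a i = arr s2 a i by exact: arr3.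
have region_lt : y * S + 2 ^ w1 <= 2 ^ w.
  by have := S_large; have := B_lt; lia.
have sim4 : simulates 11 m w1 (y * S) (init V (input y)) s4.
  split=> [r lt_r|r lt_r|a i lt_i].
  - rewrite /= /upd -{2}[11]addn0 eqn_add2l; case: eqP => // _; exact: clear3.
  - by rewrite /= /upd; case: eqP => _; rewrite ?V_lt ?expn_gt0.
  - by rewrite arr4 tab2 /= /upd; case: (a =P 0) => // _; rewrite mul1n.
have run_p := relocate_runs (isT : 9 < 11) region_lt ex_p (leqnSn _) sim4 s4_9.
apply: (runs_seq (runs_weaken run_p (leq_mul (leqnn 2) le_t) (fun _ Qs => Qs))).
move=> s5 [[reg5 reg5_lt arr5] [out5 zero5 top5]].
have s5_11 : reg s5 11 = reg sp 0 by rewrite -[11]addn0 reg5.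
have reg5' r : r < 9 -> r != 7 -> reg s5 r = reg s r.
  by move=> lt_r r7; rewrite out5 ?reg4 //; lia.
have cs5 : constants s5.
  apply: constants_same cs => [r lt_r|i]; first by apply: reg5'; lia.
  by rewrite zero5 arr4 zero2 arr1.
apply: runs_weaken.
- apply: (assign_runs _ B_gt1 (arr_le cs5) _ (@cost_lt 8 isT)).
  rewrite /= reg5' // s5_11 /d.
  by have := reg5_lt 0 isT; have := S_large; lia.
- by [].
- move=> s6'; rewrite [eval _ _]/= reg5' // s5_11 => -[s6_8 [reg6 arr6]].
  have reg6' r : r < 9 -> r != 7 -> r != 8 -> reg s6' r = reg s r.
    by move=> lt_r r7 r8; rewrite reg6 ?reg5' // /d; lia.
  split; last by rewrite reg6'.
  split.
  + apply: constants_same cs5 => [r lt_r|i]; last exact: arr6.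
    by apply: reg6; rewrite /d; lia.
  + by rewrite s6_8; apply: leq_trans (leq_add s8 (leq_b1 _)) _; rewrite addn1.
  (* The next region is still zero: the run stays below [y * S + 2 ^ w1], and the table below
     [y * S + M], where both [2 ^ w1] and [M] are at most [S]. *)
  + move=> a i; rewrite mulSn => le_i; rewrite arr6 top5; last first.
      by have := S_large; lia.
    rewrite arr4; have le_i' : y * S <= i by lia.
    rewrite -(subnKC le_i') tab2 inputE.
    case: ltnP => [lt_M|_]; last by rewrite muln0.
    by have := M_le_S; lia.
  + rewrite s6_8; have -> : (reg s 8 + (0 < reg sp 0) <> 0) <->
        (reg s 8 <> 0 \/ reg sp 0 <> 0) by lia.
    rewrite -sp0 ansE; split=> [[[y' lt_y' ans]|ans]|[y' lt_y' ans]].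
    * by exists y' => //; exact: ltnW.
    * by exists y.
    * move: lt_y'; rewrite ltnS leq_eqVlt => /orP[/eqP<-|lt_y']; first by right.
      by left; exists y'.
Qed.

Lemma reduction_runs :
  runs w reduction (init N mem) (reduction_time N M Y T)
    (fun s => reg s 0 <> 0 <-> exists2 y, y < Y & answer y).
Proof.
have [_ k_le sum_le [N_le n_le V_le M_le _]] := B_large.
pose size_step := fun n' => n' + (n' ^ k < N).
pose I j s := [/\ reg s 0 = N, reg s 1 = iter j size_step 1, reg s 8 = 0,
  forall i, arr s 0 i = mem i & fresh 0 s].
(* The search never decreases, so its intermediate values are bounded by the final one, and hence by
   [B]. *)
have step_le j : j <= N -> iter j size_step 1 <= n.
  move=> le_j; have -> : n = iter (N - j + j) size_step 1 by rewrite subnK.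
  rewrite iterD.
  by elim: (N - j) => //= i IH; apply: leq_trans IH (leq_addr _ _).
have arrB s : (forall i, arr s 0 i = mem i) -> forall i, arr s 0 i <= B.
  by move=> mems i; rewrite mems mem_le.
apply: runs_seq.
  apply: (assign_runs _ B_gt1 _ _ (@cost_lt 0 isT)) => [i|].
    by rewrite /= /upd /= mem_le.
  by rewrite /= ltnW // B_gt1.
move=> s1 [s1_1 [reg1 arr1]]; apply: runs_seq.
  apply: (@for_loop_runs _ _ _ _ _ N I) => //; first exact: w_gt0.
  - exact: leq_ltn_trans N_le B_lt.
  - by rewrite reg1.
  - by split=> [||| i|a i _]; rewrite ?s1_1 ?reg1 ?arr1 //= /upd.
  - move=> j s s' regE arrE [s0 s1' s8 mems fr].
    by split=> [||| i|a i _]; rewrite ?regE ?arrE // fr.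
  - move=> j s lt_j [s0 s1' s8 mems fr] s6 _.
    apply: runs_weaken.
    + apply: (assign_runs _ B_gt1 (arrB _ mems) _ (@cost_lt 1 isT)).
      have f1 : fits B d s (EReg 1).
        by rewrite /= s1' /=; exact: leq_trans (step_le _ (ltnW lt_j)) n_le.
      have fp := @fits_epow B d s _ k (ltnW B_gt1) f1.
      have f0 : fits B d s (EReg 0) by rewrite /= s0.
      by apply/and3P; split=> //; apply/and3P.
    + by [].
    + move=> s'; rewrite [eval _ _]/= eval_epow /= => -[s'1 [regE arrE]].
      split; rewrite ?regE //; split; rewrite ?s'1 ?s1' ?s0 ?regE //.
        by move=> i; rewrite arrE.
      by move=> a i _; rewrite arrE fr.
move=> s2 [s2_0 s2_1 s2_8 mem2 fr2]; apply: runs_seq.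
  apply: (assign_runs _ B_gt1 (arrB _ mem2) _ (@cost_lt 2 isT)).
  by rewrite /= k_le s2_1.
move=> s3 [s3_2 [reg3 arr3]]; rewrite /= s2_1 -/n in s3_2.
have mem3 i : arr s3 0 i = mem i by rewrite arr3.
apply: runs_seq.
  apply: (assign_runs _ B_gt1 (arrB _ mem3) _ (@cost_lt 3 isT)).
  by apply: fits_epow; rewrite ?(ltnW B_gt1) //= s3_2.
move=> s4 [s4_3 [reg4 arr4]]; rewrite eval_epow /= s3_2 in s4_3.
have mem4 i : arr s4 0 i = mem i by rewrite arr4.
have s4_2 : reg s4 2 = V by rewrite reg4.
apply: runs_seq.
  apply: (assign_runs _ B_gt1 (arrB _ mem4) _ (@cost_lt 4 isT)).
  by apply: fits_epow; rewrite ?(ltnW B_gt1) //= s4_2 B_gt1.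
move=> s5 [s5_4 [reg5 arr5]]; rewrite eval_epow /= s4_2 in s5_4.
have mem5 i : arr s5 0 i = mem i by rewrite arr5.
have s5_0 : reg s5 0 = N by rewrite reg5 // reg4 // reg3.
have s5_1 : reg s5 1 = n by rewrite reg5 // reg4 // reg3.
apply: runs_seq.
  apply: (assign_runs _ B_gt1 (arrB _ mem5) _ (@cost_lt 5 isT)).
  have f1 : fits B d s5 (EReg 1) by rewrite /= s5_1.
  have fp := @fits_epow B d s5 _ k (ltnW B_gt1) f1.
  have f0 : fits B d s5 (EReg 0) by rewrite /= s5_0.
  apply/and3P; split=> //; last exact: ltnW B_gt1.
  by apply/and3P; split=> //; apply/and3P.
move=> s6 [s6_5 [reg6 arr6]]; rewrite /= eval_epow /= s5_0 s5_1 in s6_5.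
have cs6 : constants s6.
  split; [by rewrite reg6|by rewrite reg6|by rewrite reg6 // reg5| |].
    by rewrite reg6 // reg5.
  by split=> [||i]; [rewrite reg6| |rewrite arr6].
have s6_8 : reg s6 8 = 0 by rewrite reg6 // reg5 // reg4 // reg3.
apply: (@runs_seq _ _ _ _ _ _ (round_invariant Y)).
  apply: for_loop_runs => //; first exact: w_gt0.
  - exact: leq_ltn_trans Y_le B_lt.
  - split=> //; first by rewrite s6_8.
      by move=> a i _; rewrite arr6 arr5 arr4 arr3 fr2.
    by rewrite s6_8; split=> // -[].
  - move=> y s s' regE arrE [cs s8 fr ansE]; split.
    + apply: constants_same cs => [r lt_r|i]; last exact: arrE.
      by apply: regE; lia.
    + by rewrite regE.
    + by move=> a i le_i; rewrite arrE; exact: fr.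
    + by rewrite regE.
  - move=> y s lt_y inv s_6 _; apply: runs_weaken (round_runs lt_y inv s_6) _ _ => //.
    by move=> s' [inv' s'6]; split=> //; case: inv' => -[_ _ _ _ []].
move=> s7 [_ s7_8 _ ansE]; exists 1, (set_reg s7 0 (reg s7 8)); split=> //.
apply: exec_Move; apply: leq_ltn_trans B_lt.
exact: leq_trans s7_8 Y_le.
Qed.

End Program.

(** The costs of the expressions depend only on [k], [h] and [c]; the program [p] enters the
    constant through the number of registers to clear, and its running time is [T]. *)
Lemma reduction_time_le k h c p : exists q, forall N M Y T,
  reduction_time k h c p N M Y T <= q * (1 + N + Y * (1 + M + T)).
Proof.
set a := (cost (esize k)).+1 + 4.
set b := (cost (evertices k)).+1 + (cost (etable h)).+1 +
  (cost (espacing c)).+1 + (cost (erounds k)).+1.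
set e := (cost ebase).+1 + 3 + (reg_bound p).+2 + 1 + (cost eanswer).+1 + 4.
set g := (cost eaddress + cost (etest k h)).+1 + 4.
pose q := 9 + a + b + e + g; exists q => N M Y T.
have -> : reduction_time k h c p N M Y T =
    9 + b + a * N + Y * (e + g * M + 2 * T).
  by rewrite /reduction_time /round_time /fill_time -/a -/g /b /e; lia.
rewrite [leqRHS]mulnDr [q * (1 + N)]mulnDr muln1; apply: leq_add; first apply: leq_add.
- by rewrite /q; lia.
- by rewrite leq_mul2r /q; apply/orP; right; lia.
- rewrite mulnCA leq_mul2l !mulnDr muln1; apply/orP; right.
  have [e_le g_le q_ge2] : [/\ e <= q, g <= q & 2 <= q] by rewrite /q; split; lia.
  apply: leq_add; [apply: leq_add => //|]; by rewrite leq_mul2r ?g_le ?q_ge2 orbT.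
Qed.

(** * Digits, cliques and progressions *)

Lemma sum_digits b h j : 0 < b ->
  \sum_(l < h) (j %/ b ^ l %% b) * b ^ l = j %% b ^ h.
Proof.
move=> b_gt0; elim: h => [|h IH]; first by rewrite big_ord0 expn0 modn1.
rewrite big_ord_recr /= IH.
have bh_gt0 : 0 < b ^ h by rewrite expn_gt0 b_gt0.
have jE : j = (j %/ b ^ h %/ b) * b ^ h.+1 + ((j %/ b ^ h %% b) * b ^ h + j %% b ^ h).
  by rewrite addnA expnS mulnA -mulnDl -divn_eq -divn_eq.
have -> : j %% b ^ h.+1 = ((j %/ b ^ h %% b) * b ^ h + j %% b ^ h) %% b ^ h.+1.
  by rewrite {1}jE modnMDl.
rewrite [RHS]modn_small; first exact: addnC.
rewrite expnS; apply: (@leq_trans ((j %/ b ^ h %% b).+1 * b ^ h)).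
  by rewrite mulSnr ltn_add2l ltn_mod.
by rewrite leq_mul2r ltn_mod b_gt0 orbT.
Qed.

Lemma sum_lt_expn b h (f : nat -> nat) : (forall i, i < h -> f i < b) ->
  \sum_(i < h) f i * b ^ i < b ^ h.
Proof.
elim: h => [|h IH] lt_f; first by rewrite big_ord0.
rewrite big_ord_recr /= expnS; have {}IH := IH (fun i lt_i => lt_f i (ltnW lt_i)).
apply: (@leq_trans ((f h).+1 * b ^ h)); first by rewrite mulSn ltn_add2r.
by rewrite leq_mul2r lt_f ?orbT.
Qed.

Lemma digit_sum b h (f : nat -> nat) l : (forall i, i < h -> f i < b) -> l < h ->
  (\sum_(i < h) f i * b ^ i) %/ b ^ l %% b = f l.
Proof.
move=> + lt_l; elim: h lt_l => // h IH; rewrite ltnS => le_l lt_f.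
have b_gt0 : 0 < b by apply: leq_ltn_trans (lt_f h (leqnn _)).
have bl_gt0 i : 0 < b ^ i by rewrite expn_gt0 b_gt0.
have lt_f' i : i < h -> f i < b by move=> lt_i; apply: lt_f; exact: ltnW.
rewrite big_ord_recr /= addnC; move: le_l; rewrite leq_eqVlt => /orP[/eqP->|lt_l].
  rewrite divnMDl // divn_small ?sum_lt_expn // addn0 modn_small //; exact: lt_f.
have -> : f h * b ^ h = f h * b ^ (h - l.+1) * b * b ^ l.
  by rewrite -!mulnA -expnS -expnD subnK.
by rewrite divnMDl // modnMDl IH.
Qed.

Lemma edge_test_perm k n y mem us vs :
  perm_eq us vs -> edge_test k n y mem us = edge_test k n y mem vs.
Proof.
move=> uv; have sumE f : sumn (map f us) = sumn (map f vs).
  by apply: perm_sumn; exact: perm_map.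
by rewrite /edge_test !sumE (perm_uniq (perm_map _ uv)).
Qed.

Lemma edge_test_uniq k n y mem us : edge_test k n y mem us -> uniq us.
Proof. by case/and3P => /map_uniq. Qed.

(** * Hypergraphs defined by a symmetric test on lists of vertices *)

Section Edges.

Variables (h V : nat) (test : seq nat -> bool).
Hypothesis V_gt0 : 0 < V.
Hypothesis test_perm : forall us vs, perm_eq us vs -> test us = test vs.
Hypothesis test_uniq : forall us, test us -> uniq us.

Definition vertex_seq (e : {set 'I_V}) : seq nat := [seq val x | x <- enum e].

Definition edges : {set {set 'I_V}} :=
  [set e : {set 'I_V} | (#|e| == h) && test (vertex_seq e)].

Lemma edges_uniform : [forall e : {set 'I_V} in edges, #|e| == h].
Proof. by apply/forallP => e; apply/implyP; rewrite inE => /andP[]. Qed.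

Definition test_hypergraph : hypergraph h V :=
  exist (fun E : {set {set 'I_V}} => [forall e in E, #|e| == h]) edges edges_uniform.

(** The tensor also has entries for tuples with repetitions. Their underlying sets have fewer than
    [h] elements and are no hyperedges, in agreement with the test, which rejects repetitions. *)
Lemma tuple_in_edges (v : h.-tuple 'I_V) :
  ([set x in v] \in edges) = test [seq val x | x <- v].
Proof.
rewrite inE.
have permE : uniq v -> perm_eq (vertex_seq [set x in v]) [seq val x | x <- v].
  move=> v_uniq; apply: perm_map; apply: uniq_perm; rewrite ?enum_uniq // => x.
  by rewrite mem_enum inE.
apply/andP/idP => [[/eqP card_v]|test_v].
  rewrite -(test_perm (permE _)) //; apply/card_uniqP.
  by rewrite size_tuple -[RHS]card_v cardsE.
have v_uniq : uniq v by rewrite -(map_inj_uniq val_inj) test_uniq.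
rewrite (test_perm (permE v_uniq)) cardsE (card_uniqP v_uniq) size_tuple.
by split.
Qed.

Lemma encode_test_hypergraph j :
  hypergraph_encode test_hypergraph j = (j < V ^ h) && test (base_digits V h j) :> nat.
Proof.
congr nat_of_bool; apply/existsP/andP => [[v /andP[/eqP jE]]|[lt_j test_j]].
  (* The tuple is extended by 0 to all of [nat], the form in which the digit lemmas apply. *)
  pose f i := if insub i is Some i' then val (tnth v i') else 0.
  have fE (i : 'I_h) : f i = tnth v i by rewrite /f valK.
  have lt_f i : i < h -> f i < V.
    by move=> lt_i; rewrite -[i]/(val (Ordinal lt_i)) fE.
  have {}jE : j = \sum_(i < h) f i * V ^ i.
    by rewrite jE; apply: eq_bigr => i _; rewrite fE.
  rewrite tuple_in_edges => test_v; split; first by rewrite jE sum_lt_expn.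
  suff -> : base_digits V h j = [seq val x | x <- v] by [].
  apply: (@eq_from_nth _ 0) => [|l]; first by rewrite !size_map size_iota size_tuple.
  rewrite size_map size_iota => lt_l.
  rewrite (nth_map 0) ?size_iota // nth_iota // add0n jE digit_sum //.
  rewrite -[l]/(val (Ordinal lt_l)) fE (nth_map (tnth v (Ordinal lt_l))) ?size_tuple //.
  by rewrite -tnth_nth.
pose v := [tuple Ordinal (ltn_pmod (j %/ V ^ l) V_gt0) | l < h].
exists v; apply/andP; split.
  apply/eqP; rewrite -(modn_small lt_j) -sum_digits //.
  by apply: eq_bigr => i _; rewrite tnth_mktuple.
rewrite tuple_in_edges; suff -> : [seq val x | x <- v] = base_digits V h j by [].
by rewrite /v /= -map_comp /base_digits -val_enum_ord -map_comp.
Qed.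

End Edges.

Lemma sumn_map_enum (I : finType) (A : {set I}) (f : I -> nat) :
  sumn [seq f i | i <- enum A] = \sum_(i in A) f i.
Proof. by rewrite sumnE big_map big_enum. Qed.

(** * Cliques as choices of one digit per part *)

Section Cliques.

Variables (k n y : nat) (mem : nat -> bool).
Hypothesis n_gt0 : 0 < n.

Let V := k * n.
Let test := edge_test k n y mem.

(* The [i]-th term of the progression with difference [1 + \sum_j v j * n ^ j]
   whose first term is [y - \sum_j j * v j * n ^ j]; it does not depend on [v i]. *)
Definition good_term (v : 'I_k -> nat) (i : nat) : bool :=
  let top := y + i + i * \sum_j v j * n ^ j in
  let shift := \sum_(j < k) j * (v j * n ^ j) in
  (shift <= top) && mem (top - shift).

(** The sums over the other parts differ from the full sums by the term of part [i]. It adds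
    [i * (v i * n ^ i)] to the top and to the shift alike, and cancels in their comparison and in
    their difference. *)
Lemma edge_test_good_term (u : 'I_k -> 'I_V) (v : 'I_k -> nat) i :
  (forall j, v j < n) -> (forall j, u j = j * n + v j :> nat) ->
  edge_test k n y mem (vertex_seq [set u j | j in [set~ i]]) = good_term v i.
Proof.
move=> lt_v uE.
have partE j : u j %/ n = j by rewrite uE divnMDl // divn_small ?addn0.
have valE j : u j %% n = v j by rewrite uE modnMDl modn_small.
have u_inj : injective u.
  by move=> j j' /(congr1 (fun x : 'I_V => x %/ n)); rewrite !partE => /val_inj.
pose us := [seq val (u j) | j <- enum [set~ i]].
have -> : edge_test k n y mem (vertex_seq [set u j | j in [set~ i]]) =
    edge_test k n y mem us.
  apply: edge_test_perm; rewrite /us map_comp; apply: perm_map.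
  apply: uniq_perm; rewrite ?enum_uniq ?map_inj_uniq ?enum_uniq // => x.
  rewrite mem_enum; apply/imsetP/mapP => -[j j_i ->]; exists j => //;
    by rewrite ?mem_enum // -mem_enum.
have sumE (f : nat -> nat) : sumn [seq f x | x <- us] + f (u i) = \sum_j f (u j).
  rewrite -map_comp sumn_map_enum [RHS](bigD1 i) //= addnC; congr (_ + _).
  by apply: eq_bigl => j; rewrite !inE.
have parts_uniq : uniq [seq x %/ n | x <- us].
  by rewrite -map_comp (eq_map partE) map_inj_uniq ?enum_uniq //; exact: val_inj.
have sum_parts : sumn (iota 0 k) - sumn [seq x %/ n | x <- us] = i.
  have := sumE (fun x => x %/ n); rewrite partE.
  have -> : \sum_(j < k) u j %/ n = sumn (iota 0 k).
    by rewrite sumnE -[in iota _ _](subn0 k) big_mkord; apply: eq_bigr => j _.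
  lia.
have sum1 := sumE (fun x => x %% n * n ^ (x %/ n)).
have sum2 := sumE (fun x => x %/ n * (x %% n * n ^ (x %/ n))).
rewrite /= partE valE in sum1; rewrite /= partE valE in sum2.
have total1 : \sum_(j < k) u j %% n * n ^ (u j %/ n) = \sum_j v j * n ^ j.
  by apply: eq_bigr => j _; rewrite partE valE.
have total2 : \sum_(j < k) u j %/ n * (u j %% n * n ^ (u j %/ n)) =
    \sum_(j < k) j * (v j * n ^ j).
  by apply: eq_bigr => j _; rewrite partE valE.
rewrite /edge_test parts_uniq sum_parts /good_term -total1 -total2 -sum1 -sum2.
rewrite mulnDr addnA leq_add2r subnDr.
by [].
Qed.

Lemma in_edges (e : {set 'I_V}) h :
  e \in val (test_hypergraph h V test) = (#|e| == h) && test (vertex_seq e).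
Proof. by rewrite inE. Qed.

Lemma imset_setC1 (T : finType) (u : 'I_k -> T) i : injective u ->
  [set u j | j in [set~ i]] = [set u j | j in setT] :\ u i.
Proof.
move=> u_inj; apply/setP => x; rewrite !inE.
apply/imsetP/andP => [[j]|[x_i /imsetP[j _ xE]]].
  by rewrite !inE => j_i ->; rewrite (inj_eq u_inj) j_i; split=> //; apply: imset_f.
by exists j => //; rewrite !inE; apply: contraNneq x_i => <-; rewrite xE.
Qed.

(** In a clique, removing a third vertex leaves a hyperedge containing any two given ones, so these
    lie in distinct parts; with [k] vertices and [k] parts, each part is hit once. Conversely, a
    [(k - 1)]-subset of a transversal omits one vertex [u i], and being a hyperedge is then the
    condition on the [i]-th term. *)
Lemma has_cliqueP : 2 < k ->
  has_clique k (test_hypergraph (k - 1) V test) <->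
  exists2 v : 'I_k -> nat, forall j, v j < n & forall i : 'I_k, good_term v i.
Proof.
move=> k_gt2; split=> [[S [card_S S_clique]]|[v lt_v good_v]]; last first.
  have lt_u (j : 'I_k) : j * n + v j < V.
    apply: (@leq_trans (j.+1 * n)); first by rewrite mulSnr ltn_add2l.
    by rewrite leq_mul2r ltn_ord orbT.
  pose u j := Ordinal (lt_u j).
  have u_inj : injective u.
    move=> j j' /(congr1 (fun x : 'I_V => x %/ n)) /=.
    by rewrite !divnMDl // !divn_small // !addn0 => /val_inj.
  exists [set u j | j in setT]; rewrite card_imset // cardsT card_ord.
  split=> // e e_sub card_e.
  have : #|[set u j | j in setT] :\: e| == 1.
    by rewrite cardsD (setIidPr e_sub) card_e card_imset // cardsT card_ord subKn //; lia.
  move=> /cards1P[x xE].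
  have : x \in [set u j | j in setT] :\: e by rewrite xE set11.
  rewrite inE => /andP[_ /imsetP[i _ x_i]].
  have eE : e = [set u j | j in [set~ i]].
    by rewrite imset_setC1 // -x_i -xE setDDr setDv set0U (setIidPr e_sub).
  by rewrite in_edges card_e eqxx eE /test (@edge_test_good_term u v i) //=.
have sub_test x : x \in S -> test (vertex_seq (S :\ x)).
  move=> x_S; have card_x : #|S :\ x| = k - 1.
    by rewrite cardsDS ?sub1set // cards1 card_S.
  by have := S_clique _ (subsetDl S [set x]) card_x; rewrite in_edges => /andP[].
have lt_part (x : 'I_V) : x %/ n < k by rewrite ltn_divLR.
pose part x := Ordinal (lt_part x).
have part_inj : {in S &, injective part}.
  move=> x x' x_S x'_S /(congr1 val) /= part_x; apply/eqP; apply: contraT => x_x'.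
  (* This is where [k > 2] enters. *)
  have [z /setDP[z_S z_xx']] : exists z, z \in S :\: [set x; x'].
    apply/set0Pn; rewrite -card_gt0 cardsDS ?cards2 ?x_x' ?card_S ?subn_gt0 //.
    by apply/subsetP => z; rewrite !inE => /orP[] /eqP->.
  have /and3P[parts_uniq _ _] := sub_test z z_S; move: parts_uniq.
  rewrite -map_comp => /(dinjectiveP (fun x : 'I_V => x %/ n)) inj_z.
  move: z_xx'; rewrite !inE negb_or => /andP[z_x z_x'].
  case/negP: x_x'; apply/eqP; apply: inj_z => //.
    by rewrite !inE eq_sym z_x.
  by rewrite !inE eq_sym z_x'.
have part_onto i : exists x, (x \in S) && (part x == i).
  have /setP/(_ i) : [set part x | x in S] = setT.
    by apply/eqP; rewrite eqEcard subsetT card_in_imset // card_S cardsT card_ord /=.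
  by rewrite in_setT => /imsetP[x x_S ->]; exists x; rewrite x_S eqxx.
have [u uP] := fin_all_exists part_onto.
have u_S i : u i \in S by have /andP[] := uP i.
have part_u i : part (u i) = i by have /andP[_ /eqP] := uP i.
have u_inj : injective u by exact: can_inj part_u.
have SE : S = [set u j | j in setT].
  apply/esym/eqP; rewrite eqEcard card_imset // cardsT card_ord card_S leqnn andbT.
  by apply/subsetP => _ /imsetP[j _ ->].
exists (fun j => u j %% n) => [j|i]; first by rewrite ltn_mod.
rewrite -(@edge_test_good_term u) => [|j|j]; last 1 first.
- by rewrite {1}(divn_eq (u j) n) -[u j %/ n]/(val (part (u j))) part_u.
- by rewrite imset_setC1 // -SE; exact: sub_test.
- by rewrite ltn_mod.
Qed.

End Cliques.

(** A decreasing progression is read backwards from its last term. The first term then belongs to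
    [A], so it is a natural number. *)
Lemma nontrivial_AP_increasing k N (A : {set 'I_N.+1}) : 0 < k ->
  has_nontrivial_AP k A -> exists x d : nat, 0 < d /\
    forall i, i < k -> exists2 a : 'I_N.+1, a \in A & a = x + i * d :> nat.
Proof.
move=> k_gt0 [x [d [d_neq0 AP]]].
wlog d_gt0 : x d d_neq0 AP / (0 < d)%Z.
  move=> IH; have [d_lt0|d_gt0] : (d < 0 \/ 0 < d)%Z by lia.
    2: exact: (IH x d).
  apply: (IH (x + Z.of_nat k.-1 * d)%Z (- d)%Z); [lia| |lia].
  move=> i lt_i; have [|a a_A aE] := AP (k.-1 - i); first lia.
  exists a => //; rewrite aE; nia.
have [a0 _ a0E] := AP 0 k_gt0.
exists (Z.to_nat x), (Z.to_nat d); split; first lia.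
move=> i lt_i; have [a a_A aE] := AP i lt_i; exists a => //; nia.
Qed.

Definition indicator N (A : {set 'I_N.+1}) (j : nat) : bool :=
  [exists a in A, j == a :> nat].

Lemma AP_iff_good_terms k n N (A : {set 'I_N.+1}) : 1 < k -> 0 < n -> N <= n ^ k ->
  has_nontrivial_AP k A <->
  exists2 y, y < N + k * n ^ k + 1 &
    exists2 v : 'I_k -> nat, forall j, v j < n &
      forall i : 'I_k, good_term n y (indicator A) v i.
Proof.
move=> k_gt1 n_gt0 le_N; split=> [AP|[y lt_y [v lt_v good_v]]]; last first.
  pose W := \sum_j v j * n ^ j; pose X := \sum_(j < k) j * (v j * n ^ j).
  exists (Z.of_nat y - Z.of_nat X)%Z, (1 + Z.of_nat W)%Z; split; first lia.
  move=> i lt_i; have : good_term n y (indicator A) v i := good_v (Ordinal lt_i).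
  rewrite /good_term -/W -/X => /andP[le_X /existsP[a /andP[a_A /eqP aE]]].
  exists a => //; have {}aE : a + X = y + i + i * W :> nat by rewrite -aE subnK.
  have iWE : (Z.of_nat i * Z.of_nat W = Z.of_nat (i * W))%Z by rewrite -Nat2Z.inj_mul.
  rewrite Z.mul_add_distr_l iWE; lia.
have [x [d [d_gt0 {}AP]]] := nontrivial_AP_increasing (ltnW k_gt1) AP.
(* The first two terms suffice to bound x and d: from x + d <= N it follows that d - 1 < n^k, so [k]
   digits represent d - 1. *)
have [a0 _ a0E] := AP 0 (ltnW k_gt1); have [a1 _ a1E] := AP 1 k_gt1.
have lt_a1 : a1 <= N by rewrite -ltnS.
pose v (j : 'I_k) := d.-1 %/ n ^ j %% n.
have WE : \sum_j v j * n ^ j = d.-1 by rewrite sum_digits // modn_small //; lia.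
pose X := \sum_(j < k) j * (v j * n ^ j).
(* The weights [j] are below [k], so [X] is at most k (d - 1). This is where the number of rounds
   comes from. *)
have le_X : X <= k * n ^ k.
  apply: (@leq_trans (k * d.-1)); last by rewrite leq_mul2l; lia.
  by rewrite -WE big_distrr; apply: leq_sum => j _; rewrite leq_mul2r ltnW ?orbT.
exists (x + X); first lia.
exists v => [j|i]; first by rewrite ltn_mod.
rewrite /good_term WE -/X; have [a a_A aE] := AP i (ltn_ord i).
apply/andP; split; first lia.
apply/existsP; exists a; rewrite a_A /= aE; apply/eqP; nia.
Qed.

(** * Size and time bounds *)

(** The base [N + 2] is at least 2 even at [N = 0], so constant factors and sums are absorbed by the
    exponent. *)
Definition polynomially_bounded (f : nat -> nat) : Prop :=
  exists q, forall N, f N <= (N + 2) ^ q.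

Lemma polynomially_bounded_le f g :
  (forall N, f N <= g N) -> polynomially_bounded g -> polynomially_bounded f.
Proof. by move=> le_fg [q le_g]; exists q => N; exact: leq_trans (le_g N). Qed.

Lemma polynomially_bounded_const a : polynomially_bounded (fun=> a).
Proof.
exists a => N; apply: leq_trans (ltnW (ltn_expl a (ltnSn 1))) _.
by case: a => // a; rewrite leq_exp2r // leq_addl.
Qed.

Lemma polynomially_bounded_id : polynomially_bounded id.
Proof. by exists 1 => N; rewrite expn1 leq_addr. Qed.

Lemma polynomially_bounded_mul f g :
  polynomially_bounded f -> polynomially_bounded g ->
  polynomially_bounded (fun N => f N * g N).
Proof.
by move=> [q le_f] [r le_g]; exists (q + r) => N; rewrite expnD leq_mul.
Qed.

Lemma polynomially_bounded_add f g :
  polynomially_bounded f -> polynomially_bounded g ->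
  polynomially_bounded (fun N => f N + g N).
Proof.
move=> [q le_f] [r le_g]; exists (q + r).+1 => N; rewrite expnS expnD.
have x_gt0 : 0 < (N + 2) ^ q by rewrite expn_gt0 addn2.
have y_gt0 : 0 < (N + 2) ^ r by rewrite expn_gt0 addn2.
apply: leq_trans (leq_add (le_f N) (le_g N)) _.
apply: (@leq_trans (2 * ((N + 2) ^ q * (N + 2) ^ r))).
  2: by rewrite leq_mul2r leq_addl orbT.
by rewrite mul2n -addnn leq_add // ?leq_pmulr ?leq_pmull.
Qed.

Lemma polynomially_bounded_exp f a :
  polynomially_bounded f -> polynomially_bounded (fun N => f N ^ a).
Proof.
move=> bd_f; elim: a => [|a IH]; first exact: polynomially_bounded_const.
apply: polynomially_bounded_le (polynomially_bounded_mul bd_f IH) => N.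
by rewrite expnS.
Qed.

Lemma add2_le_expn_bits N : N + 2 <= 2 ^ (2 * bits N).
Proof.
have : N < 2 ^ bits N by exact: trunc_log_ltn.
have : 1 < 2 ^ bits N by rewrite -[1](expn0 2) ltn_exp2l.
rewrite mul2n -addnn expnD; nia.
Qed.

(** Since [N + 2 <= 2 ^ (2 * bits N)], the power is at most [2 ^ (2 * q * L * bits N)]; the
    successor in the witness makes the inequality strict, as [bits N > 0]. *)
Lemma word_size_large f L : polynomially_bounded f ->
  exists a, forall N, f N ^ L < 2 ^ (a * bits N).
Proof.
move=> [q le_f]; exists (2 * q * L).+1 => N.
apply: (@leq_ltn_trans (2 ^ (2 * bits N * q * L))).
  2: by rewrite ltn_exp2l // /bits; lia.
rewrite !expnM; apply: leq_trans (_ : ((N + 2) ^ q) ^ L <= _).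
  by case: L => // L; rewrite leq_exp2r.
rewrite -!expnM; case: (q * L) => [|r]; first by rewrite !muln0.
by rewrite mulnA [leqRHS]expnM leq_exp2r // add2_le_expn_bits.
Qed.

Lemma part_size_le k N : part_size k N <= N + 1.
Proof.
rewrite /part_size; elim: {1 3}N => //= i IH.
by apply: leq_trans (leq_add IH (leq_b1 _)) _; lia.
Qed.

(** Either the search has stalled, which means that the bound holds, or all [N] increments took
    place and the result is [N + 1]. *)
Lemma part_size_large k N : 0 < k -> N <= part_size k N ^ k.
Proof.
move=> k_gt0; pose f n := n + (n ^ k < N).
have : N <= iter N f 1 ^ k \/ iter N f 1 = N + 1.
  elim: {2 3 4}N => [|i [IH|IH]]; [by right| |]; rewrite iterS {1 3}/f.
    by left; rewrite ltnNge IH addn0.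
  case: ltnP => [_|le_N]; last by left; rewrite addn0.
  by right; rewrite IH addnAC addSn addn1.
rewrite -/(part_size k N).
case=> // ->; apply: (@leq_trans (N + 1)); first exact: leq_addr.
by rewrite -{1}[N + 1]expn1 leq_pexp2l // addn1.
Qed.

(** The last increment was made at n - 1, so (n - 1)^k < N; and n <= 2 (n - 1) unless n = 1. Hence
    the factor [2 ^ k]. *)
Lemma part_size_small k N : 0 < N -> part_size k N ^ k <= 2 ^ k * N.
Proof.
move=> N_gt0.
pose f n := n + (n ^ k < N).
have : iter N f 1 = 1 \/ (iter N f 1 - 1) ^ k < N.
  elim: {1 2}N => [|i IH]; first by left.
  rewrite iterS {1 3}/f; case: ltnP => [lt_N|_]; last by rewrite addn0.
  by right; rewrite addnK.
rewrite -/(part_size k N).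
case=> [->|lt_N]; first by rewrite exp1n muln_gt0 expn_gt0 N_gt0.
have n_gt0 := part_size_gt0 k N.
case: (posnP (part_size k N - 1)) => [n1|n_gt1].
  have -> : part_size k N = 1 by lia.
  by rewrite exp1n muln_gt0 expn_gt0 N_gt0.
apply: (@leq_trans ((2 * (part_size k N - 1)) ^ k)).
  by case: (posnP k) => [->|k_gt0] //; rewrite leq_exp2r //; lia.
by rewrite expnMn leq_mul2l ltnW ?orbT.
Qed.

(** * The exponent of the total running time *)

Section RealBound.

Local Open Scope R_scope.

Variables (k N V Y M T q : nat) (C eps : R).
Hypothesis k_gt0 : (0 < k)%N.
Hypothesis N_gt0 : (0 < N)%N.
Hypothesis V_gt0' : (0 < V)%N.
Hypothesis V_le : (V ^ k <= (2 * k) ^ k * N)%N.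
Hypothesis Y_le' : (Y <= (k * 2 ^ k + 2) * N)%N.
Hypothesis M_le : (M <= V ^ (k - 1))%N.
Hypothesis eps_pos : 0 < eps.
Hypothesis T_le : INR T <= Rabs C * Rpower (INR V) (INR k - eps) + 1.

Let e1 := Rmin eps 1.

(** The 2 comes from 1 + N <= 2 N, [k * 2 ^ k + 2] from the number of rounds, [3 + Rabs C] from 1 +
    M + T, and [(2 * k) ^ k] from comparing V^k with N. *)
Definition time_constant (k q : nat) (C eps : R) : R :=
  INR q * (2 + INR (k * 2 ^ k + 2) *
    ((3 + Rabs C) * Rpower (INR ((2 * k) ^ k)) (1 - Rmin eps 1 / INR k))).

Lemma INR_expn a b : INR (a ^ b)%N = (INR a ^ b)%coqR.
Proof. by elim: b => [|b IH]; rewrite ?expn0 // expnS mult_INR IH. Qed.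

Lemma total_time_le :
  INR (q * (1 + N + Y * (1 + M + T)))%N <=
  time_constant k q C eps * Rpower (INR N) (2 - Rmin eps 1 / INR k).
Proof.
have k1 : 1 <= INR k by have := le_INR 1 k (ltP k_gt0).
have N1 : 1 <= INR N by have := le_INR 1 N (ltP N_gt0).
have V1 : 1 <= INR V by have := le_INR 1 V (ltP V_gt0').
have e1_pos : 0 < e1 by apply: Rmin_pos; lra.
have e1_le : e1 <= 1 by exact: Rmin_r.
have e1_eps : e1 <= eps by exact: Rmin_l.
have delta_pos : 0 < e1 / INR k by apply: Rdiv_lt_0_compat; lra.
have delta_le : e1 / INR k <= 1.
  by apply: (Rmult_le_reg_r (INR k)); [lra|field_simplify; lra].
pose P := Rpower (INR V) (INR k - e1).
have Rpower_mono a b : a <= b -> Rpower (INR V) a <= Rpower (INR V) b.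
  by move=> le_ab; exact: Rle_Rpower.
have P1 : 1 <= P.
  by rewrite -(Rpower_O (INR V)); [apply: Rpower_mono; lra|lra].
have M_P : INR M <= P.
  apply: (Rle_trans _ (INR (V ^ (k - 1)))); first exact/le_INR/leP.
  rewrite INR_expn -Rpower_pow; last lra.
  by apply: Rpower_mono; rewrite minus_INR; [simpl; lra|apply/leP].
have T_P : INR T <= (Rabs C + 1) * P.
  have : Rpower (INR V) (INR k - eps) <= P by apply: Rpower_mono; lra.
  have := Rabs_pos C; nra.
(* The bound on [V ^ k], raised to the power [1 - e1 / INR k]. *)
have P_N : P <=
    Rpower (INR ((2 * k) ^ k)) (1 - e1 / INR k) * Rpower (INR N) (1 - e1 / INR k).
  have a_pos : 0 < INR ((2 * k) ^ k).
    by apply/lt_0_INR/ltP; rewrite expn_gt0 muln_gt0 k_gt0.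
  rewrite Rpower_mult_distr; [|lra|lra].
  rewrite /P; have -> : INR k - e1 = INR k * (1 - e1 / INR k) by field; lra.
  rewrite -Rpower_mult Rpower_pow; last lra.
  apply: Rle_Rpower_l; first lra; split; first by apply: pow_lt; lra.
  by rewrite -INR_expn -mult_INR; exact/le_INR/leP.
have NN : INR N * Rpower (INR N) (1 - e1 / INR k) = Rpower (INR N) (2 - e1 / INR k).
  rewrite -{1}(Rpower_1 (INR N)); last lra.
  by rewrite -Rpower_plus; congr Rpower; lra.
have N_le : INR N <= Rpower (INR N) (2 - e1 / INR k).
  by rewrite -{1}(Rpower_1 (INR N)); [apply: Rle_Rpower; lra|lra].
have Y_N : INR Y <= INR (k * 2 ^ k + 2) * INR N.
  by rewrite -mult_INR; exact/le_INR/leP.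
rewrite mult_INR /time_constant -/e1 Rmult_assoc.
set D := INR (k * 2 ^ k + 2) in Y_N *.
apply: Rmult_le_compat_l; first exact: pos_INR.
rewrite !plus_INR mult_INR !plus_INR.
rewrite [INR 1]/=.
set K1 := Rpower _ _ in P_N *.
set Q := Rpower (INR N) (1 - _) in P_N NN; set Z := Rpower (INR N) _ in NN N_le *.
have Y_pos : 0 <= INR Y by exact: pos_INR.
have D_pos : 0 <= D by exact: pos_INR.
have Q_pos : 0 < Q by exact: exp_pos.
have K_pos : 0 < K1 by exact: exp_pos.
have C_pos := Rabs_pos C.
have inner : 1 + INR M + INR T <= (3 + Rabs C) * K1 * Q.
  apply: (Rle_trans _ ((3 + Rabs C) * P)); first nra.
  by rewrite Rmult_assoc; apply: Rmult_le_compat_l; lra.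
have outer : INR Y * (1 + INR M + INR T) <= (D * INR N) * ((3 + Rabs C) * K1 * Q).
  by apply: Rmult_le_compat => //; have := pos_INR M; have := pos_INR T; lra.
apply: (Rle_trans _ (2 * Z + D * INR N * ((3 + Rabs C) * K1 * Q))); first lra.
rewrite -NN; right; ring.
Qed.

End RealBound.

(** Turns the real time bound of the clique algorithm into one natural number valid for all rounds;
    the absolute value covers a negative [x]. *)
Lemma nat_upper_bound (x : R) : exists T,
  (INR T <= Rabs x + 1)%coqR /\ forall t, (INR t <= x)%coqR -> t <= T.
Proof.
have [up_gt up_le] := archimed x; exists (Z.to_nat (up x)); split.
  rewrite INR_IZR_INZ; have := Rabs_pos x; have := Rle_abs x => x_le x_pos.
  case: (Z_le_gt_dec 0 (up x)) => [up_pos|up_neg]; first by rewrite Z2Nat.id //; lra.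
  by rewrite (_ : Z.to_nat _ = 0); [simpl; lra|lia].
move=> t t_le; have : (IZR (Z.of_nat t) < IZR (up x))%coqR.
  by rewrite -INR_IZR_INZ; lra.
by move/lt_IZR; lia.
Qed.

(** The sum plays the role of [B]: it dominates each quantity that the program handles, including
    the end [Y * S] of the last region. *)
Lemma reduction_values_bounded k h c :
  polynomially_bounded (fun N =>
    let n := part_size k N in let V := k * n in
    k + sumn (iota 0 k) + 2 + N + n + V + V ^ h +
    (N + k * n ^ k + 1) * (2 * V) ^ c).
Proof.
have bd_n : polynomially_bounded (part_size k).
  apply: (polynomially_bounded_le (part_size_le k)).
  apply: polynomially_bounded_add; first exact: polynomially_bounded_id.
  exact: polynomially_bounded_const.
have bd_id := polynomially_bounded_id.
have bd_V := polynomially_bounded_mul (polynomially_bounded_const k) bd_n.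
do ![apply: polynomially_bounded_add | apply: polynomially_bounded_mul |
     apply: polynomially_bounded_exp | exact: polynomially_bounded_const |
     exact: bd_id | exact: bd_n | exact: bd_V].
Qed.

Theorem theorem5p2 :
  forall k : nat, 4 <= k ->
  AP_hypothesis k -> hyperclique_hypothesis k (k - 1).
Proof.
move=> k k_ge4 AP_hard [eps [eps_pos [p [c [C p_fast]]]]]; apply: AP_hard.
(* Enlarging the words of the clique algorithm makes a region large enough for the adjacency tensor
   with its [V ^ (k - 1)] entries. *)
pose h := k - 1; pose c' := c + k.
have [cw cw_large] := word_size_large (max_cost k h c') (reduction_values_bounded k h c').
have [q time_le] := reduction_time_le k h c' p.
have k_gt0 : 0 < k by lia.
exists (Rmin eps 1 / INR k)%coqR; split.
  apply: Rdiv_lt_0_compat; first by apply: Rmin_pos; lra.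
  exact/lt_0_INR/ltP.
exists (reduction k h c' p), cw, (time_constant k q C eps) => N A.
pose n := part_size k N; pose V := k * n.
have n_gt0 : 0 < n := part_size_gt0 k N.
have V_gt0 : 0 < V by rewrite muln_gt0 k_gt0.
pose G y := test_hypergraph h V (edge_test k n y (indicator A)).
pose answer y := has_clique k (G y).
have [T [T_le T_max]] := nat_upper_bound (C * Rpower (INR V) (INR k - eps)).
have inputE y j : hypergraph_encode (G y) j =
    (j < V ^ h) && edge_test k n y (indicator A) (base_digits V h j) :> nat.
  apply: encode_test_hypergraph => //; first exact: edge_test_perm.
  exact: edge_test_uniq.
have p_correct y : y < N + k * n ^ k + 1 -> exists t s,
    [/\ exec (c' * bits V) p (init V (hypergraph_encode (G y))) t s, t <= T
      & answer y <-> reg s 0 <> 0].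
  move=> _; have [t [s [ex_p ans t_le]]] := p_fast V (G y).
  exists t, s; split=> //; last exact/T_max/t_le.
  by apply: exec_monotone ex_p; rewrite leq_mul2r leq_addr orbT.
have B_large (B := k + sumn (iota 0 k) + 2 + N + n + V + V ^ h +
      (N + k * n ^ k + 1) * (2 * V) ^ c') :
    [/\ 1 < B, k <= B, sumn (iota 0 k) <= B
      & [/\ N <= B, n <= B, V <= B, V ^ h <= B
          & (N + k * n ^ k + 1) * (2 * V) ^ c' <= B]].
  by rewrite /B; do ![split]; lia.
have c'_gt0 : 0 < c' by rewrite /c'; lia.
have h_le : h <= c' by rewrite /h /c'; lia.
have [t [s [ex_red t_le ans]]] :=
  reduction_runs k_gt0 c'_gt0 h_le B_large (cw_large N) inputE p_correct.
exists t, s; split=> // [|N_gt0].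
  have answerP y := has_cliqueP y (indicator A) n_gt0 (ltnW k_ge4).
  rewrite /= (@AP_iff_good_terms k n N A) ?part_size_large //; last lia.
  by rewrite ans; split=> -[y lt_y /answerP good]; exists y.
have V_small : V ^ k <= (2 * k) ^ k * N.
  by rewrite !expnMn -mulnA mulnCA leq_mul2l (part_size_small k N_gt0) orbT.
have Y_small : N + k * n ^ k + 1 <= (k * 2 ^ k + 2) * N.
  have := leq_mul (leqnn k) (part_size_small k N_gt0); rewrite -/n; nia.
have total := @total_time_le k N V _ (V ^ h) T q C eps k_gt0 N_gt0 V_gt0
  V_small Y_small (leqnn _) eps_pos.
apply: Rle_trans (total _).
  by apply/le_INR/leP; exact: leq_trans t_le (time_le _ _ _ _).
apply: Rle_trans T_le _.
rewrite Rabs_mult (Rabs_pos_eq (Rpower _ _)); first lra.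
by left; exact: exp_pos.
Qed.
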